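(* Let $z\in\mathbb{C}$ with $\mathrm{Im}(z)>0$, $q=e^{2\pi i z}$ (with $q^{\alpha}:=e^{2\pi i\alpha z}$ for real $\alpha$), let $a>0$ and $b\in\mathbb{R}$. Put $$\psi_1(t,q)=\sum_{n=1}^{\infty}(-1)^n n\,q^{an^2+bn}\cos(2nt),\qquad \psi_2(t,q)=-\sum_{n=1}^{\infty}(-1)^n n\,q^{an^2-bn}\cos(2nt).$$ Then $$\int_0^{\pi}\psi_1(t,q)\log\left(\frac{\vartheta_4(t,q)}{\vartheta_4(0,q)}\right)dt=-\pi\sum_{n=1}^{\infty}\frac{(-1)^nq^{an^2+(b+1)n}}{1-q^{2n}},$$ $$\int_0^{\pi}\psi_2(t,q)\log\left(\frac{\vartheta_4(t,q)}{\vartheta_4(0,q)}\right)dt=\pi\sum_{n=1}^{\infty}\frac{(-1)^nq^{an^2+(-b+1)n}}{1-q^{2n}}.$$ Consequently, with $\psi(t,q)=\psi_1(t,q)+\psi_2(t,q)=\sum_{n=-\infty}^{\infty}(-1)^nq^{an^2+bn}n\cos(2nt)$ and $I=\int_0^{\pi}\psi(t,q)\log\left(\frac{\vartheta_4(t,q)}{\vartheta_4(0,q)}\right)dt$, one has $$I=-\pi\sum_{n\in\mathbb{Z}\setminus\{0\}}\frac{(-1)^nq^{an^2+bn}}{q^{-n}-q^{n}} \quad\text{and}\quad \frac{I}{\pi}=\frac{1}{2}\sum_{n\in\mathbb{Z}\setminus\{0\}}\frac{(-1)^n\exp\left(2\pi i(an^2+bn)z\right)}{\sinh(2\pi i n 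z)}.$$
   Context: $\vartheta_4(t,q)=\sum_{n=-\infty}^{\infty}(-1)^nq^{n^2}e^{2int}$. The logarithm $\log(\vartheta_4(t,q)/\vartheta_4(0,q))$ is the branch continuous in $t\in[0,\pi]$ that vanishes at $t=0$. *)

(* Defs.v *)
From Stdlib Require Import Reals ZArith.
From Coquelicot Require Import Coquelicot.
Open Scope R_scope.

Definition cexp (w : C) : C :=
  (exp (Re w) * cos (Im w), exp (Re w) * sin (Im w))%R.

Definition csinh (w : C) : C := ((cexp w - cexp (- w)) / RtoC 2)%C.

Definition qpow (z : C) (alpha : R) : C :=
  cexp (RtoC (2 * PI) * Ci * RtoC alpha * z)%C.

(* sum of a complex series (defined componentwise via Coquelicot's Series;
   all series used below converge absolutely) *)
Definition CSeries (f : nat -> C) : C :=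
  (Series (fun n => Re (f n)), Series (fun n => Im (f n))).

Definition zsum_nonzero (f : Z -> C) : C :=
  (CSeries (fun n => f (Z.of_nat (S n))) + CSeries (fun n => f (- Z.of_nat (S n))%Z))%C.

Definition zsum (f : Z -> C) : C := (f 0%Z + zsum_nonzero f)%C.

Definition sgn1 (n : Z) : R := (-1) ^ (Z.abs_nat n).

Definition theta4 (z : C) (t : R) : C :=
  zsum (fun n => RtoC (sgn1 n) * qpow z (IZR n ^ 2)
                  * cexp (Ci * RtoC (2 * IZR n * t)))%C.

Definition psi1 (a b : R) (z : C) (t : R) : C :=
  CSeries (fun k => let n := INR (S k) in
    RtoC ((-1) ^ (S k) * n * cos (2 * n * t)) * qpow z (a * n ^ 2 + b * n))%C.

Definition psi2 (a b : R) (z : C) (t : R) : C :=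
  (- CSeries (fun k => let n := INR (S k) in
    RtoC ((-1) ^ (S k) * n * cos (2 * n * t)) * qpow z (a * n ^ 2 - b * n))%C)%C.

Definition log_theta4_branch (z : C) (L : R -> C) : Prop :=
  L 0 = RtoC 0 /\
  (forall t, 0 <= t <= PI ->
     filterlim L (within (fun u => 0 <= u <= PI) (locally t)) (locally (L t))) /\
  (forall t, 0 <= t <= PI -> (theta4 z 0 * cexp (L t))%C = theta4 z t).

(* Main.v *)
(** The Jacobi triple product writes theta_4(t) as a constant times
    prod_n (1 - q^(2n-1) w) (1 - q^(2n-1) / w), w = e^(2it), and expanding the
    logarithms of the factors gives theta_4(t) = const * exp (F t) with
    F(t) = - sum_m 2 q^m cos(2mt) / (m (1 - q^(2m))).  Since exp (L - (F - F 0)) = 1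
    on [0, pi], continuity forces L = F - F 0.  Orthogonality of the cosines then
    gives int_0^pi cos(2nt) L(t) dt = - pi q^n / (n (1 - q^(2n))), and the Gaussian
    decay of the coefficients of psi_1 and psi_2 allows termwise integration.
    The triple product itself is the limit of the q-binomial theorem, the q-Pochhammer
    symbols being written as exponentials of series, so that all limits are
    dominated convergence of series. *)

Require Import Defs.
From Stdlib Require Import Reals ZArith Lra Lia.
From Coquelicot Require Import Coquelicot.
Open Scope R_scope.

(** * Complex series, limits and the exponential *)

(** The logarithm of a product is then a sum of series, free of 2 pi i ambiguities, and a
    q-Pochhammer symbol, being an exponential, is nonzero and is bounded above and below as soon as
    its logarithm is bounded. This justifies the divisions in the q-binomial theorem, gives the
    majorant, uniform in n and k, for the q-binomial coefficients, and shows that theta_4(0) is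
    nonzero. The branch [L] is arbitrary and known only on [0, pi], while uniform convergence is
    handled on the whole line. Hence [L] is identified with an explicit cosine series, bounded and
    Lipschitz on all of R, before anything is integrated. *)

Lemma Series_tail_small (M : nat -> R) (eps : R) :
  ex_series M -> 0 < eps ->
  exists K, Rabs (Series (fun k => M (S K + k)%nat)) < eps.
Proof.
  intros HM Heps.
  assert (H : is_lim_seq (sum_n M) (Series M)) by exact (Series_correct _ HM).
  apply is_lim_seq_spec in H; destruct (H (mkposreal _ Heps)) as [K HK].
  exists K; specialize (HK K (le_n K)); simpl in HK.
  rewrite (Series_incr_n M (S K)) in HK; [|lia|exact HM].
  rewrite sum_n_Reals in HK; simpl pred in HK.
  rewrite <- Rabs_Ropp; refine (Rle_lt_trans _ _ _ (Req_le _ _ _) HK).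
  f_equal; ring.
Qed.

Lemma Rabs_Series_le (f M : nat -> R) :
  (forall k, Rabs (f k) <= M k) -> ex_series M -> Rabs (Series f) <= Series M.
Proof.
  intros Hf HM.
  apply Rle_trans with (Series (fun k => Rabs (f k))).
  - apply Series_Rabs, (ex_series_le (fun k => Rabs (f k)) M); [|exact HM].
    intros n; change (Rabs (Rabs (f n)) <= M n); rewrite Rabs_Rabsolu; apply Hf.
  - apply Series_le; [|exact HM].
    intros n; split; [apply Rabs_pos | apply Hf].
Qed.

Lemma is_lim_seq_sum_f_R0 (f : nat -> nat -> R) (g : nat -> R) (K : nat) :
  (forall k, is_lim_seq (fun N => f N k) (g k)) ->
  is_lim_seq (fun N => sum_f_R0 (f N) K) (sum_f_R0 g K).
Proof.
  intros H; induction K as [|K IH]; simpl; [apply H|].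
  apply is_lim_seq_plus'; [exact IH | apply H].
Qed.

(** Tannery's theorem: beyond an index [K] that depends on [M] and [eps] alone, both tails are below
    a third of [eps], and the finite head converges term by term. *)
Lemma is_lim_seq_Series_dominated (f : nat -> nat -> R) (g M : nat -> R) :
  (forall N k, Rabs (f N k) <= M k) -> ex_series M ->
  (forall k, is_lim_seq (fun N => f N k) (g k)) ->
  is_lim_seq (fun N => Series (f N)) (Series g).
Proof.
  intros Hf HM Hlim.
  assert (Hg : forall k, Rabs (g k) <= M k).
  { intros k.
    apply (is_lim_seq_le (fun N => Rabs (f N k)) (fun _ => M k) (Rabs (g k)) (M k)).
    - intros N; apply Hf.
    - exact (is_lim_seq_abs _ (g k) (Hlim k)).
    - apply is_lim_seq_const. }
  assert (ex : forall h, (forall k, Rabs (h k) <= M k) -> ex_series h).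
  { intros h Hh; exact (ex_series_le (h : nat -> R_CompleteNormedModule) M Hh HM). }
  apply is_lim_seq_spec; intros eps.
  assert (He : 0 < eps / 3) by (destruct eps; simpl; lra).
  destruct (Series_tail_small M (eps / 3) HM He) as [K HK].
  assert (HMK : ex_series (fun k => M (S K + k)%nat)) by (apply ex_series_incr_n; exact HM).
  assert (tail : forall h, (forall k, Rabs (h k) <= M k) ->
     Rabs (Series (fun k => h (S K + k)%nat)) < eps / 3).
  { intros h Hh.
    eapply Rle_lt_trans; [apply (Rabs_Series_le _ (fun k => M (S K + k)%nat)); auto|].
    eapply Rle_lt_trans; [apply Rle_abs | exact HK]. }
  generalize (is_lim_seq_sum_f_R0 f g K Hlim); intros HS.
  apply is_lim_seq_spec in HS; destruct (HS (mkposreal _ He)) as [N HN]; simpl in HN.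
  exists N; intros n Hn; specialize (HN n Hn).
  rewrite (Series_incr_n (f n) (S K)), (Series_incr_n g (S K)); auto with arith.
  simpl pred.
  generalize (tail _ (Hf n)) (tail _ Hg); revert HN.
  generalize (sum_f_R0 (f n) K) (sum_f_R0 g K)
    (Series (fun k => f n (S K + k)%nat)) (Series (fun k => g (S K + k)%nat)).
  intros x y u v; unfold Rabs; repeat destruct Rcase_abs; lra.
Qed.

(** Absolute convergence is stated through the modulus, so that one real majorant controls both
    components of [CSeries]. *)
Definition csummable (f : nat -> C) : Prop := ex_series (fun n => Cmod (f n)).

Lemma C_eq (x y : C) : Re x = Re y -> Im x = Im y -> x = y.
Proof. destruct x, y; simpl; intros; subst; reflexivity. Qed.

Lemma im_le_Cmod (x : C) : Rabs (Im x) <= Cmod x.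
Proof. exact (Rle_trans _ _ _ (Rmax_r _ _) (Rmax_Cmod x)). Qed.

Lemma csummable_le (f : nat -> C) (M : nat -> R) :
  (forall n, Cmod (f n) <= M n) -> ex_series M -> csummable f.
Proof.
  intros H HM; apply (ex_series_le (fun n => Cmod (f n)) M); [|exact HM].
  intros n; change (Rabs (Cmod (f n)) <= M n).
  rewrite Rabs_pos_eq; [apply H | apply Cmod_ge_0].
Qed.

Lemma csummable_ex_series_Re (f : nat -> C) :
  csummable f -> ex_series (fun n => Re (f n)).
Proof.
  intros H; apply (ex_series_le (fun n => Re (f n)) (fun n => Cmod (f n))); [|exact H].
  intros n; apply re_le_Cmod.
Qed.

Lemma csummable_ex_series_Im (f : nat -> C) :
  csummable f -> ex_series (fun n => Im (f n)).
Proof.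
  intros H; apply (ex_series_le (fun n => Im (f n)) (fun n => Cmod (f n))); [|exact H].
  intros n; apply im_le_Cmod.
Qed.

#[local] Hint Resolve csummable_ex_series_Re csummable_ex_series_Im : core.

Lemma CSeries_ext (f g : nat -> C) :
  (forall n, f n = g n) -> CSeries f = CSeries g.
Proof.
  intros H; unfold CSeries; f_equal; apply Series_ext; intros n; rewrite H; reflexivity.
Qed.

Lemma CSeries_plus (f g : nat -> C) :
  csummable f -> csummable g ->
  CSeries (fun n => f n + g n)%C = (CSeries f + CSeries g)%C.
Proof.
  intros Hf Hg; unfold CSeries; apply C_eq; simpl; rewrite <- Series_plus; auto.
Qed.

Lemma CSeries_scal (c : C) (f : nat -> C) :
  csummable f -> CSeries (fun n => c * f n)%C = (c * CSeries f)%C.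
Proof.
  intros Hf; unfold CSeries; apply C_eq; simpl.
  - rewrite <- (Series_scal_l (Re c)), <- (Series_scal_l (Im c)), <- Series_minus.
    + reflexivity.
    + exact (ex_series_scal (Re c) _ (csummable_ex_series_Re _ Hf)).
    + exact (ex_series_scal (Im c) _ (csummable_ex_series_Im _ Hf)).
  - rewrite <- (Series_scal_l (Re c)), <- (Series_scal_l (Im c)), <- Series_plus.
    + reflexivity.
    + exact (ex_series_scal (Re c) _ (csummable_ex_series_Im _ Hf)).
    + exact (ex_series_scal (Im c) _ (csummable_ex_series_Re _ Hf)).
Qed.

Lemma CSeries_opp (f : nat -> C) :
  CSeries (fun n => - f n)%C = (- CSeries f)%C.
Proof.
  unfold CSeries; apply C_eq; simpl; rewrite <- Series_opp; reflexivity.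
Qed.

Lemma CSeries_minus (f g : nat -> C) :
  csummable f -> csummable g ->
  CSeries (fun n => f n - g n)%C = (CSeries f - CSeries g)%C.
Proof.
  intros Hf Hg; unfold CSeries; apply C_eq; simpl;
    unfold Rminus; rewrite <- Series_opp, <- Series_plus; auto;
    refine (ex_series_opp _ _); auto.
Qed.

Lemma Cmod_le_Re_Im (x : C) : Cmod x <= Rabs (Re x) + Rabs (Im x).
Proof.
  assert (x = (RtoC (Re x) + Ci * RtoC (Im x))%C) as E
    by (apply C_eq; simpl; ring).
  rewrite E at 1.
  eapply Rle_trans; [apply Cmod_triangle|].
  rewrite Cmod_mult, !Cmod_R, Cmod_Ci; lra.
Qed.

(** Each component is bounded by [Series M] separately; the resulting factor 2 stands in for the
    sharp triangle inequality and only affects constants. *)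
Lemma Cmod_CSeries_le (f : nat -> C) (M : nat -> R) :
  (forall n, Cmod (f n) <= M n) -> ex_series M ->
  Cmod (CSeries f) <= 2 * Series M.
Proof.
  intros H HM; eapply Rle_trans; [apply Cmod_le_Re_Im|].
  assert (Rabs (Re (CSeries f)) <= Series M).
  { apply (Rabs_Series_le (fun n => Re (f n)) M); [|exact HM].
    intros k; eapply Rle_trans; [apply re_le_Cmod | apply H]. }
  assert (Rabs (Im (CSeries f)) <= Series M).
  { apply (Rabs_Series_le (fun n => Im (f n)) M); [|exact HM].
    intros k; eapply Rle_trans; [apply im_le_Cmod | apply H]. }
  lra.
Qed.

Definition is_clim (f : nat -> C) (l : C) : Prop :=
  is_lim_seq (fun n => Re (f n)) (Re l) /\ is_lim_seq (fun n => Im (f n)) (Im l).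

Lemma is_clim_unique (f : nat -> C) (l l' : C) :
  is_clim f l -> is_clim f l' -> l = l'.
Proof.
  intros [H1 H2] [H3 H4]; apply C_eq.
  - apply is_lim_seq_unique in H1; apply is_lim_seq_unique in H3; congruence.
  - apply is_lim_seq_unique in H2; apply is_lim_seq_unique in H4; congruence.
Qed.

Lemma is_clim_ext (f g : nat -> C) (l : C) :
  (forall n, f n = g n) -> is_clim f l -> is_clim g l.
Proof.
  intros E [H1 H2]; split;
    eapply is_lim_seq_ext; try eassumption; intros n; simpl; rewrite E; reflexivity.
Qed.

Lemma is_clim_ext_loc (f g : nat -> C) (l : C) :
  eventually (fun n => f n = g n) -> is_clim f l -> is_clim g l.
Proof.
  intros [N E] [H1 H2]; split;
    eapply is_lim_seq_ext_loc; try eassumption; exists N; intros n Hn;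
    rewrite (E n Hn); reflexivity.
Qed.

Lemma is_clim_const (l : C) : is_clim (fun _ => l) l.
Proof. split; apply is_lim_seq_const. Qed.

Lemma is_clim_plus (f g : nat -> C) (l l' : C) :
  is_clim f l -> is_clim g l' -> is_clim (fun n => f n + g n)%C (l + l')%C.
Proof. intros [H1 H2] [H3 H4]; split; simpl; apply is_lim_seq_plus'; assumption. Qed.

Lemma is_clim_opp (f : nat -> C) (l : C) :
  is_clim f l -> is_clim (fun n => - f n)%C (- l)%C.
Proof.
  intros [H1 H2]; split.
  - exact (proj1 (is_lim_seq_opp _ (Re l)) H1).
  - exact (proj1 (is_lim_seq_opp _ (Im l)) H2).
Qed.

Lemma is_clim_mult (f g : nat -> C) (l l' : C) :
  is_clim f l -> is_clim g l' -> is_clim (fun n => f n * g n)%C (l * l')%C.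
Proof.
  intros [H1 H2] [H3 H4]; split; simpl.
  - apply is_lim_seq_minus'; apply is_lim_seq_mult'; assumption.
  - apply is_lim_seq_plus'; apply is_lim_seq_mult'; assumption.
Qed.

Lemma is_clim_subseq (f : nat -> C) (l : C) (phi : nat -> nat) :
  filterlim phi eventually eventually -> is_clim f l -> is_clim (fun n => f (phi n)) l.
Proof.
  intros Hphi [H1 H2]; split;
    [exact (is_lim_seq_subseq _ _ phi Hphi H1) | exact (is_lim_seq_subseq _ _ phi Hphi H2)].
Qed.

Lemma is_clim_Cmod_0 (f : nat -> C) :
  is_lim_seq (fun n => Cmod (f n)) 0 -> is_clim f 0%C.
Proof.
  intros H; split; simpl; apply is_lim_seq_abs_0;
    apply (is_lim_seq_le_le (fun _ => 0) _ (fun n => Cmod (f n)));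
    try apply is_lim_seq_const; try exact H; intros n;
    (split; [apply Rabs_pos | apply re_le_Cmod || apply im_le_Cmod]).
Qed.

Lemma is_clim_CSeries_dominated (f : nat -> nat -> C) (g : nat -> C) (M : nat -> R) :
  (forall N k, Cmod (f N k) <= M k) -> ex_series M ->
  (forall k, is_clim (fun N => f N k) (g k)) ->
  is_clim (fun N => CSeries (f N)) (CSeries g).
Proof.
  intros Hf HM Hlim; split; simpl.
  - apply (is_lim_seq_Series_dominated (fun N k => Re (f N k)) (fun k => Re (g k)) M);
      [|exact HM | intros k; apply (Hlim k)].
    intros N k; eapply Rle_trans; [apply re_le_Cmod | apply Hf].
  - apply (is_lim_seq_Series_dominated (fun N k => Im (f N k)) (fun k => Im (g k)) M);
      [|exact HM | intros k; apply (Hlim k)].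
    intros N k; eapply Rle_trans; [apply im_le_Cmod | apply Hf].
Qed.

Lemma cexp_add (u v : C) : cexp (u + v) = (cexp u * cexp v)%C.
Proof.
  unfold cexp; apply C_eq; simpl; unfold Re, Im; simpl;
    rewrite exp_plus, ?cos_plus, ?sin_plus; ring.
Qed.

Lemma cexp_0 : cexp 0 = 1%C.
Proof. unfold cexp; apply C_eq; simpl; rewrite exp_0, ?cos_0, ?sin_0; ring. Qed.

Lemma Cmod_cexp (u : C) : Cmod (cexp u) = exp (Re u).
Proof.
  unfold cexp, Cmod; cbn [fst snd].
  replace ((exp (Re u) * cos (Im u)) ^ 2 + (exp (Re u) * sin (Im u)) ^ 2)
    with ((exp (Re u)) ^ 2 * ((sin (Im u))² + (cos (Im u))²)) by (unfold Rsqr; ring).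
  rewrite sin2_cos2, Rmult_1_r; apply sqrt_pow2, Rlt_le, exp_pos.
Qed.

Lemma cexp_neq_0 (u : C) : cexp u <> 0%C.
Proof.
  intros H; apply (f_equal Cmod) in H; rewrite Cmod_cexp, Cmod_0 in H.
  generalize (exp_pos (Re u)); lra.
Qed.

Lemma cexp_opp (u : C) : cexp (- u) = (/ cexp u)%C.
Proof.
  assert (cexp (- u) * cexp u = 1)%C as E
    by (rewrite <- cexp_add, <- cexp_0; f_equal; ring).
  rewrite <- (Cmult_1_r (cexp (- u))), <- (Cinv_r (cexp u)) by apply cexp_neq_0.
  rewrite Cmult_assoc, E; ring.
Qed.

Lemma cexp_pow (u : C) (n : nat) : (cexp u ^ n)%C = cexp (RtoC (INR n) * u).
Proof.
  induction n as [|n IH].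
  - simpl; rewrite Cmult_0_l, cexp_0; reflexivity.
  - rewrite Cpow_S, IH, <- cexp_add, S_INR, RtoC_plus; f_equal; ring.
Qed.

Lemma cexp_eq_1 (u : C) :
  cexp u = 1%C -> Re u = 0 /\ exists k : Z, Im u = IZR k * (2 * PI).
Proof.
  intros H.
  assert (HR : Re u = 0).
  { apply (f_equal Cmod) in H; rewrite Cmod_cexp, Cmod_1 in H.
    apply exp_inv; rewrite H, exp_0; reflexivity. }
  split; [exact HR|].
  unfold cexp in H; rewrite HR, exp_0 in H.
  apply (f_equal Re) in H; simpl in H; rewrite Rmult_1_l in H.
  (* The half-angle turns cos y = 1 into sin (y / 2) = 0, whose solutions are the multiples of
     pi. *)
  replace (Im u) with (2 * (Im u / 2)) in H by field.
  rewrite cos_2a_sin in H.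
  assert (Hs : sin (Im u / 2) = 0) by nra.
  apply sin_eq_0_0 in Hs; destruct Hs as [k Hk]; exists k.
  replace (Im u) with (2 * (Im u / 2)) by field; rewrite Hk; ring.
Qed.

Lemma is_clim_cexp (f : nat -> C) (l : C) :
  is_clim f l -> is_clim (fun n => cexp (f n)) (cexp l).
Proof.
  intros [H1 H2].
  assert (HE := is_lim_seq_continuous exp _ _
    (derivable_continuous_pt _ _ (derivable_pt_exp (Re l))) H1).
  split; simpl; apply is_lim_seq_mult'; try exact HE.
  - exact (is_lim_seq_continuous cos _ _ (continuity_cos (Im l)) H2).
  - exact (is_lim_seq_continuous sin _ _ (continuity_sin (Im l)) H2).
Qed.

(** * Logarithms of q-Pochhammer symbols *)

Lemma ex_series_geom_Cmod (u : C) : Cmod u < 1 -> ex_series (fun k => Cmod u ^ k).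
Proof. intros H; apply ex_series_geom; rewrite Rabs_pos_eq; [exact H | apply Cmod_ge_0]. Qed.

Lemma csummable_geom (u : C) : Cmod u < 1 -> csummable (fun k => u ^ k)%C.
Proof.
  intros H; apply csummable_le with (fun k => Cmod u ^ k).
  - intros n; rewrite Cmod_pow; apply Rle_refl.
  - apply ex_series_geom_Cmod, H.
Qed.

Lemma one_minus_neq_0 (u : C) : Cmod u < 1 -> (1 - u)%C <> 0%C.
Proof.
  intros H E; assert (u = 1%C) as -> by (rewrite <- (Cplus_0_r u), <- E; ring).
  rewrite Cmod_1 in H; lra.
Qed.

Lemma CSeries_incr_1 (f : nat -> C) :
  csummable f -> CSeries f = (f 0%nat + CSeries (fun k => f (S k)))%C.
Proof.
  intros H; unfold CSeries; apply C_eq; simpl; apply Series_incr_1; auto.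
Qed.

Lemma Cinv_unique_l (x y : C) : (x * y)%C = 1%C -> x = (/ y)%C.
Proof.
  intros H; assert (Hy : y <> 0%C).
  { intros E; rewrite E, Cmult_0_r in H; apply C1_nz; symmetry; exact H. }
  transitivity (x * y * / y)%C; [field; exact Hy | rewrite H; ring].
Qed.

Lemma CSeries_geom (u : C) : Cmod u < 1 -> CSeries (fun k => u ^ k)%C = (/ (1 - u))%C.
Proof.
  intros H.
  assert (E := CSeries_incr_1 _ (csummable_geom u H)); simpl in E.
  rewrite (CSeries_scal u _ (csummable_geom u H)) in E.
  set (s := CSeries (fun k => u ^ k)%C) in *.
  apply Cinv_unique_l; transitivity (s - u * s)%C; [ring|]; rewrite E at 1; ring.
Qed.

Lemma Cmod_pow_le_1 (u : C) (k : nat) : Cmod u <= 1 -> Cmod (u ^ k) <= 1.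
Proof.
  intros H; rewrite Cmod_pow, <- (pow1 k); apply pow_incr.
  split; [apply Cmod_ge_0 | exact H].
Qed.

Lemma INR_S_ge_1 (k : nat) : 1 <= INR (S k).
Proof. rewrite S_INR; generalize (pos_INR k); lra. Qed.

Lemma RtoC_INR_S_neq_0 (k : nat) : RtoC (INR (S k)) <> 0%C.
Proof. intros E; apply RtoC_inj in E; generalize (INR_S_ge_1 k); lra. Qed.

Lemma Cmod_div_INR_S_le (u : C) (k : nat) : Cmod (u / RtoC (INR (S k))) <= Cmod u.
Proof.
  generalize (INR_S_ge_1 k); intros H.
  rewrite Cmod_div, Cmod_R, Rabs_pos_eq by (lra || apply RtoC_INR_S_neq_0).
  apply Rmult_le_reg_r with (INR (S k)); [lra|].
  unfold Rdiv; rewrite Rmult_assoc, Rinv_l, Rmult_1_r by lra.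
  generalize (Cmod_ge_0 u); nra.
Qed.

Lemma csummable_log (u : C) :
  Cmod u < 1 -> csummable (fun k => u ^ S k / RtoC (INR (S k)))%C.
Proof.
  intros H; apply csummable_le with (fun k => Cmod u ^ k); [|apply ex_series_geom_Cmod, H].
  intros k; eapply Rle_trans; [apply Cmod_div_INR_S_le|].
  rewrite Cpow_S, Cmod_mult, Cmod_pow.
  generalize (Cmod_ge_0 u) (pow_le (Cmod u) k (Cmod_ge_0 u)); nra.
Qed.

(** A radius strictly above 1 lets the power series be differentiated on the whole closed segment
    [0, 1], including the endpoint where its value is wanted. *)
Lemma CV_radius_gt_1 (a : nat -> R) (rho : R) :
  0 <= rho < 1 -> (forall k, Rabs (a k) <= rho ^ k) -> Rbar_lt 1 (CV_radius a).
Proof.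
  intros Hr Ha.
  (* This [r] exceeds 1 while [rho * r] stays at most 1, so the terms [a n * r ^ n] are bounded by
     1. *)
  set (r := 2 / (1 + rho)).
  assert (Hr1 : r * (1 + rho) = 2) by (unfold r; field; lra).
  apply Rbar_lt_le_trans with r; [simpl; nra|].
  apply (CV_radius_bounded a); exists 1; intros n.
  rewrite Rabs_mult, <- RPow_abs, (Rabs_pos_eq r) by nra.
  apply Rle_trans with (rho ^ n * r ^ n).
  - apply Rmult_le_compat_r; [apply pow_le; nra | apply Ha].
  - rewrite <- Rpow_mult_distr, <- (pow1 n); apply pow_incr; nra.
Qed.

Lemma log_coef_bound (u : C) (k : nat) :
  Cmod (match k with O => RtoC 0 | S j => u ^ S j / RtoC (INR (S j)) end)%C <= Cmod u ^ k.
Proof.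
  destruct k as [|j]; [rewrite Cmod_0; simpl; lra|].
  eapply Rle_trans; [apply Cmod_div_INR_S_le | rewrite Cmod_pow; apply Rle_refl].
Qed.

(* The function [s |-> (1 - s u) exp (sum_k (s u)^(k+1)/(k+1))] has zero
   derivative on [0, 1]. *)
Lemma cexp_log_series (u : C) :
  Cmod u < 1 ->
  cexp (- CSeries (fun k => u ^ S k / RtoC (INR (S k)))%C) = (1 - u)%C.
Proof.
  intros Hu.
  (* The zero constant term aligns index and exponent and makes the power series vanish at s = 0. *)
  set (c := fun k => match k with O => RtoC 0 | S j => (u ^ S j / RtoC (INR (S j)))%C end).
  set (a := fun k => Re (c k)); set (b := fun k => Im (c k)).
  assert (Hrho : 0 <= Cmod u < 1) by (split; [apply Cmod_ge_0 | exact Hu]).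
  assert (Ra : Rbar_lt 1 (CV_radius a)).
  { apply CV_radius_gt_1 with (Cmod u); [exact Hrho|]; intros k.
    eapply Rle_trans; [apply re_le_Cmod | apply log_coef_bound]. }
  assert (Rb : Rbar_lt 1 (CV_radius b)).
  { apply CV_radius_gt_1 with (Cmod u); [exact Hrho|]; intros k.
    eapply Rle_trans; [apply im_le_Cmod | apply log_coef_bound]. }
  assert (dA : forall s, 0 <= s <= 1 ->
            is_derive (PSeries a) s (PSeries (PS_derive a) s)).
  { intros s Hs; apply is_derive_PSeries; eapply Rbar_le_lt_trans; [|exact Ra].
    simpl; rewrite Rabs_pos_eq; lra. }
  assert (dB : forall s, 0 <= s <= 1 ->
            is_derive (PSeries b) s (PSeries (PS_derive b) s)).
  { intros s Hs; apply is_derive_PSeries; eapply Rbar_le_lt_trans; [|exact Rb].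
    simpl; rewrite Rabs_pos_eq; lra. }
  (* The derivative of the series at [s] is a geometric series with sum u / (1 - s u), written here
     with the denominator cleared. *)
  assert (Hd : forall s, 0 <= s <= 1 ->
    ((1 - RtoC s * u) * (PSeries (PS_derive a) s, PSeries (PS_derive b) s))%C = u).
  { intros s Hs.
    assert (Hsu : Cmod (RtoC s * u) < 1).
    { rewrite Cmod_mult, Cmod_R, Rabs_pos_eq by lra; generalize (Cmod_ge_0 u); nra. }
    assert (E : (PSeries (PS_derive a) s, PSeries (PS_derive b) s)
                = CSeries (fun k => u * (RtoC s * u) ^ k)%C).
    { assert (Ec : forall k, (u * (RtoC s * u) ^ k)%C
         = (RtoC (INR (S k) * s ^ k) * c (S k))%C).
      { intros k; unfold c; rewrite Cpow_mult_l, Cpow_S, RtoC_mult, RtoC_pow; field.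
        apply RtoC_INR_S_neq_0. }
      unfold CSeries, PSeries, PS_derive, a, b; f_equal; apply Series_ext; intros k;
        rewrite Ec; [|]; generalize (c (S k)) (INR (S k)); intros [x y] n; simpl; ring. }
    rewrite E, (CSeries_scal u _ (csummable_geom _ Hsu)), (CSeries_geom _ Hsu).
    field; apply one_minus_neq_0, Hsu. }
  set (A := PSeries a) in *; set (B := PSeries b) in *.
  set (A' := PSeries (PS_derive a)) in *; set (B' := PSeries (PS_derive b)) in *.
  destruct u as [x y]; set (u := (x, y)) in *.
  (* [h1] and [h2] are the real and imaginary parts of (1 - s u) exp (A + i B), so that the
     constancy argument involves real functions only. *)
  set (h1 := fun s => exp (A s) * ((1 - s * x) * cos (B s) + s * y * sin (B s))).
  set (h2 := fun s => exp (A s) * ((1 - s * x) * sin (B s) - s * y * cos (B s))).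
  assert (Hd1 : forall s, 0 <= s <= 1 -> (1 - s * x) * A' s + s * y * B' s = x).
  { intros s Hs; generalize (f_equal Re (Hd s Hs)); simpl; lra. }
  assert (Hd2 : forall s, 0 <= s <= 1 -> (1 - s * x) * B' s - s * y * A' s = y).
  { intros s Hs; generalize (f_equal Im (Hd s Hs)); simpl; lra. }
  assert (E1 : h1 0 = h1 1).
  { apply (eq_is_derive h1 0 1); [|lra]; intros s Hs; unfold h1.
    generalize (dA s Hs) (dB s Hs) (Hd1 s Hs) (Hd2 s Hs); intros da db e1 e2.
    auto_derive; [repeat split; eexists; eassumption|].
    replace (Derive (fun x => A x) s) with (A' s) by (symmetry; apply is_derive_unique, da).
    replace (Derive (fun x => B x) s) with (B' s) by (symmetry; apply is_derive_unique, db).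
    change zero with 0.
    transitivity (exp (A s) * (cos (B s) * ((1 - s * x) * A' s + s * y * B' s - x)
      - sin (B s) * ((1 - s * x) * B' s - s * y * A' s - y))); [ring|].
    rewrite e1, e2; ring. }
  assert (E2 : h2 0 = h2 1).
  { apply (eq_is_derive h2 0 1); [|lra]; intros s Hs; unfold h2.
    generalize (dA s Hs) (dB s Hs) (Hd1 s Hs) (Hd2 s Hs); intros da db e1 e2.
    auto_derive; [repeat split; eexists; eassumption|].
    replace (Derive (fun x => A x) s) with (A' s) by (symmetry; apply is_derive_unique, da).
    replace (Derive (fun x => B x) s) with (B' s) by (symmetry; apply is_derive_unique, db).
    change zero with 0.
    transitivity (exp (A s) * (sin (B s) * ((1 - s * x) * A' s + s * y * B' s - x)
      + cos (B s) * ((1 - s * x) * B' s - s * y * A' s - y))); [ring|].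
    rewrite e1, e2; ring. }
  assert (A0 : A 0 = 0) by (unfold A; rewrite PSeries_0; reflexivity).
  assert (B0 : B 0 = 0) by (unfold B; rewrite PSeries_0; reflexivity).
  unfold h1 in E1; unfold h2 in E2.
  rewrite A0, B0, exp_0, cos_0, sin_0 in E1, E2.
  assert (EL : CSeries (fun k => u ^ S k / RtoC (INR (S k)))%C = (A 1, B 1)).
  { assert (S1 : CSeries c = CSeries (fun k => c (S k))).
    { rewrite CSeries_incr_1; [unfold c at 1; ring|].
      apply csummable_le with (fun k => Cmod u ^ k); [apply log_coef_bound|].
      apply ex_series_geom_Cmod, Hu. }
    change (fun k => (u ^ S k / RtoC (INR (S k)))%C) with (fun k => c (S k)).
    rewrite <- S1; unfold CSeries, A, B, PSeries, a, b.
    f_equal; apply Series_ext; intros k; rewrite pow1; ring. }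
  rewrite EL, cexp_opp; symmetry; apply Cinv_unique_l.
  apply C_eq; simpl; unfold u; simpl; lra.
Qed.

Fixpoint cprod (f : nat -> C) (n : nat) : C :=
  match n with O => 1%C | S m => (cprod f m * f m)%C end.

Definition qpoch (u v : C) (n : nat) : C := cprod (fun j => 1 - u * v ^ j)%C n.

(** Summing the series of log (1 - u v^j) over j < n and exchanging the sums leaves, for each k, the
    finite geometric sum (1 - v^(nk)) / (1 - v^k). Letting n grow removes v^(nk) and gives
    [log_qpoch_inf]. *)
Definition log_qpoch (u v : C) (n : nat) : C :=
  (- CSeries (fun k => u ^ S k * (1 - v ^ (n * S k))
                       / (RtoC (INR (S k)) * (1 - v ^ S k)))%C)%C.

Definition log_qpoch_inf (u v : C) : C :=
  (- CSeries (fun k => u ^ S k / (RtoC (INR (S k)) * (1 - v ^ S k)))%C)%C.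

Lemma Cmod_pow_S_lt_1 (v : C) (k : nat) : Cmod v < 1 -> Cmod (v ^ S k) < 1.
Proof.
  intros H; rewrite Cpow_S, Cmod_mult.
  generalize (Cmod_ge_0 v) (Cmod_ge_0 (v ^ k)) (Cmod_pow_le_1 v k (Rlt_le _ _ H)); nra.
Qed.

Lemma Cmod_one_minus_pow_ge (v : C) (k : nat) :
  Cmod v < 1 -> 1 - Cmod v <= Cmod (1 - v ^ S k).
Proof.
  intros H.
  assert (Cmod (v ^ S k) <= Cmod v).
  { rewrite Cpow_S, Cmod_mult.
    generalize (Cmod_ge_0 v) (Cmod_ge_0 (v ^ k)) (Cmod_pow_le_1 v k (Rlt_le _ _ H)); nra. }
  generalize (Cmod_triangle (1 - v ^ S k) (v ^ S k)).
  replace (1 - v ^ S k + v ^ S k)%C with (RtoC 1) by ring.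
  rewrite Cmod_1; lra.
Qed.

Lemma Cmod_one_minus_le (w : C) : Cmod w <= 1 -> Cmod (1 - w) <= 2.
Proof.
  intros H; eapply Rle_trans; [apply Cmod_triangle|].
  rewrite Cmod_1, Cmod_opp; lra.
Qed.

(** The weight [w] is left free so that w = 1 - v^(nk) and w = 1 share one geometric majorant, which
    does not depend on n. *)
Lemma Cmod_log_qpoch_term_le (u v w : C) (k : nat) :
  Cmod u < 1 -> Cmod v < 1 -> Cmod w <= 2 ->
  Cmod (u ^ S k * w / (RtoC (INR (S k)) * (1 - v ^ S k)))
  <= 2 / (1 - Cmod v) * Cmod u ^ k.
Proof.
  intros Hu Hv Hw.
  assert (H1 := one_minus_neq_0 _ (Cmod_pow_S_lt_1 v k Hv)).
  replace (u ^ S k * w / (RtoC (INR (S k)) * (1 - v ^ S k)))%C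
    with (((u * u ^ k) * w / (1 - v ^ S k)) / RtoC (INR (S k)))%C
    by (rewrite (Cpow_S u); field; split; [exact H1 | apply RtoC_INR_S_neq_0]).
  eapply Rle_trans; [apply Cmod_div_INR_S_le|].
  rewrite Cmod_div, !Cmod_mult, Cmod_pow by exact H1.
  generalize (Cmod_one_minus_pow_ge v k Hv) (Cmod_ge_0 u)
    (pow_le (Cmod u) k (Cmod_ge_0 u)) (Cmod_ge_0 w); intros H2 H3 H4 H5.
  replace (2 / (1 - Cmod v) * Cmod u ^ k) with ((1 * Cmod u ^ k) * 2 * / (1 - Cmod v))
    by (field; lra).
  apply Rmult_le_compat.
  - repeat apply Rmult_le_pos; assumption.
  - apply Rlt_le, Rinv_0_lt_compat; lra.
  - apply Rmult_le_compat; try assumption; [apply Rmult_le_pos; assumption|].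
    apply Rmult_le_compat_r; lra.
  - apply Rinv_le_contravar; lra.
Qed.

Lemma Cmod_log_qpoch_term_le' (u v : C) (n k : nat) :
  Cmod u < 1 -> Cmod v < 1 ->
  Cmod (u ^ S k * (1 - v ^ (n * S k)) / (RtoC (INR (S k)) * (1 - v ^ S k)))
  <= 2 / (1 - Cmod v) * Cmod u ^ k.
Proof.
  intros Hu Hv; apply Cmod_log_qpoch_term_le; try assumption.
  apply Cmod_one_minus_le, Cmod_pow_le_1, Rlt_le, Hv.
Qed.

Lemma ex_series_scal_geom_Cmod (c : R) (u : C) :
  Cmod u < 1 -> ex_series (fun k => c * Cmod u ^ k).
Proof. intros H; exact (ex_series_scal c _ (ex_series_geom_Cmod u H)). Qed.

Lemma csummable_log_qpoch (u v : C) (n : nat) :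
  Cmod u < 1 -> Cmod v < 1 ->
  csummable (fun k => u ^ S k * (1 - v ^ (n * S k))
                       / (RtoC (INR (S k)) * (1 - v ^ S k)))%C.
Proof.
  intros Hu Hv; eapply csummable_le;
    [intros k; apply Cmod_log_qpoch_term_le'; assumption|].
  apply ex_series_scal_geom_Cmod, Hu.
Qed.

Lemma csummable_log_qpoch_inf (u v : C) :
  Cmod u < 1 -> Cmod v < 1 ->
  csummable (fun k => u ^ S k / (RtoC (INR (S k)) * (1 - v ^ S k)))%C.
Proof.
  intros Hu Hv; eapply csummable_le.
  - intros k; rewrite <- (Cmult_1_r (u ^ S k)).
    apply (Cmod_log_qpoch_term_le u v 1 k); try assumption; rewrite Cmod_1; lra.
  - apply ex_series_scal_geom_Cmod, Hu.
Qed.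

(** A new factor 1 - u v^n adds its own logarithmic series, and (1 - v^(nk)) + v^(nk) (1 - v^k) = 1
    - v^((n+1)k) merges it with the old one. *)
Lemma qpoch_cexp (u v : C) (n : nat) :
  Cmod u < 1 -> Cmod v < 1 -> qpoch u v n = cexp (log_qpoch u v n).
Proof.
  intros Hu Hv; induction n as [|n IH].
  - unfold qpoch, log_qpoch; simpl cprod.
    replace (CSeries _) with (0 * CSeries (fun k => u ^ k))%C.
    + rewrite <- cexp_0; f_equal; ring.
    + rewrite <- (CSeries_scal 0 _ (csummable_geom u Hu)); apply CSeries_ext; intros k.
      simpl (0 * _)%nat; simpl (v ^ 0)%C; unfold Cdiv; ring.
  - unfold qpoch in *; simpl cprod; rewrite IH.
    assert (Hw : Cmod (u * v ^ n) < 1).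
    { rewrite Cmod_mult.
      generalize (Cmod_ge_0 u) (Cmod_ge_0 (v ^ n)) (Cmod_pow_le_1 v n (Rlt_le _ _ Hv)); nra. }
    rewrite <- (cexp_log_series _ Hw), <- cexp_add; f_equal; unfold log_qpoch.
    transitivity (- (CSeries (fun k => u ^ S k * (1 - v ^ (n * S k))
                       / (RtoC (INR (S k)) * (1 - v ^ S k)))
        + CSeries (fun k => (u * v ^ n) ^ S k / RtoC (INR (S k)))))%C; [ring|].
    rewrite <- CSeries_plus
      by (apply csummable_log, Hw || apply csummable_log_qpoch; assumption).
    f_equal; apply CSeries_ext; intros k.
    rewrite Cpow_mult_l, <- Cpow_mult_r.
    replace (S n * S k)%nat with (n * S k + S k)%nat by ring.
    rewrite (Cpow_add_r v (n * S k)); field.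
    split; [apply one_minus_neq_0, Cmod_pow_S_lt_1, Hv | apply RtoC_INR_S_neq_0].
Qed.

Lemma Cmod_log_qpoch_le (u v : C) :
  Cmod u < 1 -> Cmod v < 1 -> exists B, forall n, Cmod (log_qpoch u v n) <= B.
Proof.
  intros Hu Hv; eexists; intros n; unfold log_qpoch; rewrite Cmod_opp.
  apply Cmod_CSeries_le.
  - intros k; apply Cmod_log_qpoch_term_le'; assumption.
  - apply ex_series_scal_geom_Cmod, Hu.
Qed.

Lemma filterlim_pow_index (k : nat) :
  filterlim (fun n => (n * S k)%nat) eventually eventually.
Proof. intros P [N HN]; exists N; intros n Hn; apply HN; nia. Qed.

Lemma is_clim_pow_0 (v : C) : Cmod v < 1 -> is_clim (fun n => v ^ n)%C 0%C.
Proof.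
  intros Hv; apply is_clim_Cmod_0.
  apply (is_lim_seq_ext (fun n => Cmod v ^ n)); [intros n; symmetry; apply Cmod_pow|].
  apply is_lim_seq_geom; rewrite Rabs_pos_eq; [exact Hv | apply Cmod_ge_0].
Qed.

Lemma is_clim_log_qpoch (u v : C) :
  Cmod u < 1 -> Cmod v < 1 -> is_clim (log_qpoch u v) (log_qpoch_inf u v).
Proof.
  intros Hu Hv; apply is_clim_opp.
  eapply is_clim_CSeries_dominated;
    [intros n k; apply Cmod_log_qpoch_term_le'; assumption
    |apply ex_series_scal_geom_Cmod, Hu|].
  intros k; cbv beta.
  replace (u ^ S k / (RtoC (INR (S k)) * (1 - v ^ S k)))%C
    with (u ^ S k * (1 + - 0) * / (RtoC (INR (S k)) * (1 - v ^ S k)))%C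
    by (unfold Cdiv; ring).
  apply is_clim_mult; [apply is_clim_mult|]; try apply is_clim_const.
  apply is_clim_plus; [apply is_clim_const|]; apply is_clim_opp.
  exact (is_clim_subseq _ _ _ (filterlim_pow_index k) (is_clim_pow_0 v Hv)).
Qed.

(** * The finite triple product *)

(** The upper bound is excluded, so that empty ranges are allowed and ranges concatenate without
    shifts. *)
Fixpoint csum (f : nat -> C) (n : nat) : C :=
  match n with O => 0%C | S m => (csum f m + f m)%C end.

Lemma csum_ext (f g : nat -> C) (n : nat) :
  (forall k, (k < n)%nat -> f k = g k) -> csum f n = csum g n.
Proof.
  induction n as [|n IH]; intros H; simpl; [reflexivity|].
  rewrite IH, H; [reflexivity | lia | intros; apply H; lia].
Qed.

Lemma cprod_ext (f g : nat -> C) (n : nat) :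
  (forall k, (k < n)%nat -> f k = g k) -> cprod f n = cprod g n.
Proof.
  induction n as [|n IH]; intros H; simpl; [reflexivity|].
  rewrite IH, H; [reflexivity | lia | intros; apply H; lia].
Qed.

Lemma csum_plus (f g : nat -> C) (n : nat) :
  csum (fun k => f k + g k)%C n = (csum f n + csum g n)%C.
Proof. induction n as [|n IH]; simpl; [|rewrite IH]; ring. Qed.

Lemma csum_scal (c : C) (f : nat -> C) (n : nat) :
  csum (fun k => c * f k)%C n = (c * csum f n)%C.
Proof. induction n as [|n IH]; simpl; [|rewrite IH]; ring. Qed.

Lemma cprod_mult (f g : nat -> C) (n : nat) :
  cprod (fun k => f k * g k)%C n = (cprod f n * cprod g n)%C.
Proof. induction n as [|n IH]; simpl; [|rewrite IH]; ring. Qed.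

Lemma csum_add (f : nat -> C) (m n : nat) :
  csum f (m + n) = (csum f m + csum (fun k => f (m + k)%nat) n)%C.
Proof.
  induction n as [|n IH]; simpl; [rewrite Nat.add_0_r; ring|].
  rewrite Nat.add_succ_r; simpl; rewrite IH; ring.
Qed.

Lemma cprod_add (f : nat -> C) (m n : nat) :
  cprod f (m + n) = (cprod f m * cprod (fun k => f (m + k)%nat) n)%C.
Proof.
  induction n as [|n IH]; simpl; [rewrite Nat.add_0_r; ring|].
  rewrite Nat.add_succ_r; simpl; rewrite IH; ring.
Qed.

Lemma csum_first (f : nat -> C) (n : nat) :
  csum f (S n) = (f 0%nat + csum (fun k => f (S k)) n)%C.
Proof. change (S n) with (1 + n)%nat; rewrite csum_add; simpl; ring. Qed.

Lemma csum_rev (f : nat -> C) (n : nat) :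
  csum f n = csum (fun k => f (n - S k)%nat) n.
Proof.
  induction n as [|n IH]; [reflexivity|].
  rewrite (csum_first (fun k => f (S n - S k)%nat)).
  change (csum f (S n)) with (csum f n + f n)%C; rewrite IH, Cplus_comm.
  f_equal; f_equal; lia.
Qed.

Lemma cprod_rev (f : nat -> C) (n : nat) :
  cprod f n = cprod (fun k => f (n - S k)%nat) n.
Proof.
  induction n as [|n IH]; [reflexivity|].
  change (cprod (fun k => f (S n - S k)%nat) (S n))
    with (cprod (fun k => f (S n - S k)%nat) (1 + n)); rewrite cprod_add.
  change (cprod f (S n)) with (cprod f n * f n)%C; rewrite IH, Cmult_comm.
  f_equal; simpl; rewrite Cmult_1_l; f_equal; lia.
Qed.

(** Gauss's formula in base q^2, which turns the usual exponent k(k-1)/2 into k(k-1) and avoids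
    halving. The induction rests on the q-Pascal rule, which for whole terms reads B(n+1, k+1) =
    B(n, k+1) + x p^n B(n, k) with p = q^2. *)
Lemma q_binomial (q x : C) (n : nat) :
  (forall m, qpoch (q * q) (q * q) m <> 0%C) ->
  cprod (fun j => 1 + x * (q * q) ^ j)%C n
  = csum (fun k => q ^ (k * (k - 1)) * x ^ k
       * (qpoch (q * q) (q * q) n
          / (qpoch (q * q) (q * q) k * qpoch (q * q) (q * q) (n - k))))%C (S n).
Proof.
  set (p := (q * q)%C); set (E := qpoch p p); intros HE.
  assert (ES : forall m, E (S m) = (E m * (1 - p ^ S m))%C).
  { intros m; unfold E, qpoch; simpl; ring. }
  assert (E0 : E 0%nat = 1%C) by reflexivity.
  assert (Hp : forall m, (1 - p ^ S m)%C <> 0%C).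
  { intros m H; apply (HE (S m)); rewrite ES, H; ring. }
  induction n as [|n IH].
  - simpl; rewrite E0; field; apply C1_nz.
  - simpl cprod; rewrite IH; clear IH.
    set (B := fun n k => (q ^ (k * (k - 1)) * x ^ k * (E n / (E k * E (n - k)%nat)))%C).
    change (csum (B n) (S n) * (1 + x * p ^ n) = csum (B (S n)) (S (S n)))%C.
    assert (H0 : forall m, B m 0%nat = 1%C).
    { intros m; unfold B; rewrite E0, Nat.sub_0_r; simpl; field; apply HE. }
    (* The last term needs its own rule: truncated subtraction does not make [B n (S n)] vanish, so
       the Pascal rule is only used for k < n. *)
    assert (Hn : B (S n) (S n) = (x * p ^ n * B n n)%C).
    { unfold B; rewrite !Nat.sub_diag, E0.
      replace (S n * (S n - 1))%nat with (n * (n - 1) + (n + n))%nat by nia.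
      unfold p; rewrite !Cpow_add_r, Cpow_mult_l, (Cpow_S x); field; auto using C1_nz. }
    assert (Hk : forall k, (k < n)%nat ->
              B (S n) (S k) = (B n (S k) + x * p ^ n * B n k)%C).
    { intros k Hkn; destruct (Nat.le_exists_sub (S k) n Hkn) as [m [-> _]].
      unfold B.
      replace (S (m + S k) - S k)%nat with (S m) by lia.
      replace (m + S k - S k)%nat with m by lia.
      replace (m + S k - k)%nat with (S m) by lia.
      replace (S k * (S k - 1))%nat with (k * (k - 1) + (k + k))%nat by nia.
      rewrite Cpow_add_r, (Cpow_S x), !ES.
      replace (q ^ (k + k))%C with (p ^ k)%C
        by (unfold p; rewrite Cpow_mult_l, Cpow_add_r; reflexivity).
      replace (p ^ S (m + S k))%C with (p ^ S m * p ^ S k)%C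
        by (rewrite <- Cpow_add_r; reflexivity).
      replace (p ^ (m + S k))%C with (p ^ S m * p ^ k)%C
        by (rewrite <- Cpow_add_r; f_equal; lia).
      generalize (Hp k) (Hp m) (HE k) (HE m); intros; field; auto. }
    rewrite (csum_first (B (S n))), H0.
    change (csum (fun k => B (S n) (S k)) (S n))
      with (csum (fun k => B (S n) (S k)) n + B (S n) (S n))%C.
    rewrite (csum_ext _ _ n Hk), csum_plus, csum_scal, Hn.
    transitivity (csum (B n) (S n) + x * p ^ n * csum (B n) (S n))%C; [ring|].
    rewrite csum_first at 1; rewrite H0; simpl csum; ring.
Qed.

(** * Powers of q and the monomials q^a e^(is) *)

Lemma qpow_add (z : C) (a b : R) : (qpow z a * qpow z b)%C = qpow z (a + b).
Proof. unfold qpow; rewrite <- cexp_add, RtoC_plus; f_equal; ring. Qed.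

Lemma qpow_0 (z : C) : qpow z 0 = 1%C.
Proof. unfold qpow; rewrite <- cexp_0; f_equal; ring. Qed.

Lemma qpow_opp (z : C) (a : R) : qpow z (- a) = (/ qpow z a)%C.
Proof. unfold qpow; rewrite <- cexp_opp, RtoC_opp; f_equal; ring. Qed.

Lemma qpow_neq_0 (z : C) (a : R) : qpow z a <> 0%C.
Proof. apply cexp_neq_0. Qed.

Lemma qpow_pow (z : C) (a : R) (n : nat) : (qpow z a ^ n)%C = qpow z (INR n * a).
Proof. unfold qpow; rewrite cexp_pow, (RtoC_mult (INR n)); f_equal; ring. Qed.

Lemma Cmod_qpow (z : C) (a : R) : Cmod (qpow z a) = exp (- (2 * PI * Im z) * a).
Proof. unfold qpow; rewrite Cmod_cexp; f_equal; destruct z; simpl; ring. Qed.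

Lemma Cmod_qpow_lt_1 (z : C) (a : R) : 0 < Im z -> 0 < a -> Cmod (qpow z a) < 1.
Proof.
  intros Hz Ha; rewrite Cmod_qpow, <- exp_0; apply exp_increasing.
  generalize PI_RGT_0; intros HP.
  assert (0 < PI * Im z * a) by (apply Rmult_lt_0_compat; [apply Rmult_lt_0_compat|]; lra); lra.
Qed.

(** Keeping both exponents as real arguments makes a product of monomials an addition of exponents,
    so identities between monomials are left to [ring]. *)
Definition qe (z : C) (a s : R) : C := (qpow z a * cexp (Ci * RtoC s))%C.

Lemma qe_add (z : C) (a b s t : R) : (qe z a s * qe z b t)%C = qe z (a + b) (s + t).
Proof.
  unfold qe; rewrite <- qpow_add, RtoC_plus, Cmult_plus_distr_l, cexp_add; ring.
Qed.

Lemma qe_0 (z : C) : qe z 0 0 = 1%C.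
Proof.
  unfold qe; rewrite qpow_0, Cmult_0_r, cexp_0; ring.
Qed.

Lemma qe_pow (z : C) (a s : R) (n : nat) :
  (qe z a s ^ n)%C = qe z (INR n * a) (INR n * s).
Proof.
  unfold qe; rewrite Cpow_mult_l, qpow_pow, cexp_pow, RtoC_mult.
  f_equal; f_equal; ring.
Qed.

Lemma Cmod_cexp_Ci (s : R) : Cmod (cexp (Ci * RtoC s)) = 1.
Proof. rewrite Cmod_cexp, <- exp_0; f_equal; simpl; ring. Qed.

Lemma Cmod_qe (z : C) (a s : R) : Cmod (qe z a s) = Cmod (qpow z a).
Proof. unfold qe; rewrite Cmod_mult, Cmod_cexp_Ci; ring. Qed.

Lemma Cmod_qe_lt_1 (z : C) (a s : R) : 0 < Im z -> 0 < a -> Cmod (qe z a s) < 1.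
Proof. rewrite Cmod_qe; apply Cmod_qpow_lt_1. Qed.

(** The Gaussian binomial coefficient of 2n over n + k in base q^2. For k > n truncated subtraction
    gives a junk value, but only k <= n enters the sums. *)
Definition central_qbinom (z : C) (n k : nat) : C :=
  (qpoch (qe z 2 0) (qe z 2 0) (n + n)
   / (qpoch (qe z 2 0) (qe z 2 0) (n + k) * qpoch (qe z 2 0) (qe z 2 0) (n - k)))%C.

(* Only half of the factors [1 - w q^(2j+1-2n)], [j < 2n], of the q-binomial
   product have a positive power of [q]; in the others a monomial is pulled out. *)
Lemma finite_triple_product (z : C) (s : R) (n : nat) :
  0 < Im z ->
  (qpoch (qe z 1 s) (qe z 2 0) n * qpoch (qe z 1 (- s)) (qe z 2 0) n)%C
  = (central_qbinom z n 0
     + csum (fun i => RtoC ((-1) ^ S i)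
         * (qe z (INR (S i) ^ 2) (INR (S i) * s) + qe z (INR (S i) ^ 2) (- (INR (S i) * s)))
         * central_qbinom z n (S i)) n)%C.
Proof.
  intros Hz.
  assert (Hq2 : (qe z 1 0 * qe z 1 0)%C = qe z 2 0) by (rewrite qe_add; f_equal; ring).
  assert (Hlt : Cmod (qe z 2 0) < 1) by (apply Cmod_qe_lt_1; lra).
  assert (HE : forall m, qpoch (qe z 2 0) (qe z 2 0) m <> 0%C).
  { intros m; rewrite qpoch_cexp by assumption; apply cexp_neq_0. }
  set (N := INR n).
  set (x := (- qe z (1 - 2 * N) s)%C).
  assert (HB := q_binomial (qe z 1 0) x (n + n)).
  rewrite Hq2 in HB; specialize (HB HE).
  (* [c] is the inverse of the product of the n monomials pulled out; the exponent n^2 is the sum of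
     the first n odd numbers. *)
  set (c := (RtoC ((-1) ^ n) * qe z (N ^ 2) (- (N * s)))%C).
  assert (Hfac : forall j, (x * qe z 2 0 ^ j)%C = (- qe z (2 * INR j + 1 - 2 * N) s)%C).
  { intros j; unfold x; rewrite qe_pow.
    transitivity (- (qe z (1 - 2 * N) s * qe z (INR j * 2) (INR j * 0)))%C; [ring|].
    rewrite qe_add; f_equal; f_equal; ring. }
  assert (HP : (qpoch (qe z 1 s) (qe z 2 0) n * qpoch (qe z 1 (- s)) (qe z 2 0) n)%C
    = (c * cprod (fun j => 1 + x * qe z 2 0 ^ j) (n + n))%C).
  { rewrite cprod_add, cprod_rev.
    rewrite (cprod_ext (fun k => 1 + x * qe z 2 0 ^ (n - S k))%C
      (fun k => (- qe z (- (2 * INR k + 1)) s) * (1 - qe z 1 (- s) * qe z 2 0 ^ k))%C).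
    2:{ intros k Hk; rewrite Hfac, qe_pow, qe_add, minus_INR, S_INR by lia; fold N.
        transitivity (1 - qe z (2 * (N - (INR k + 1)) + 1 - 2 * N) s)%C; [ring|].
        transitivity (- qe z (- (2 * INR k + 1)) s
          + (qe z (- (2 * INR k + 1)) s * qe z (1 + INR k * 2) (- s + INR k * 0)))%C; [|ring].
        rewrite qe_add.
        replace (- (2 * INR k + 1)) with (2 * (N - (INR k + 1)) + 1 - 2 * N) by ring.
        replace (qe z (_ + (1 + _)) _) with (RtoC 1)
          by (rewrite <- (qe_0 z); f_equal; ring).
        ring. }
    rewrite (cprod_ext (fun k => 1 + x * qe z 2 0 ^ (n + k))%C
      (fun k => 1 - qe z 1 s * qe z 2 0 ^ k)%C).
    2:{ intros k Hk; rewrite Hfac, qe_pow, qe_add, plus_INR; fold N.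
        unfold Cminus; do 2 f_equal; f_equal; ring. }
    rewrite cprod_mult; unfold qpoch.
    assert (Hm : forall m, (RtoC ((-1) ^ m) * qe z (INR m ^ 2) (- (INR m * s))
                 * cprod (fun k => - qe z (- (2 * INR k + 1)) s) m = 1)%C).
    { induction m as [|m IH].
      - simpl; replace (qe z _ _) with (RtoC 1)
          by (rewrite <- (qe_0 z); f_equal; ring).
        ring.
      - simpl cprod; rewrite S_INR; rewrite <- IH.
        simpl ((-1) ^ S m); rewrite RtoC_mult.
        replace (qe z (INR m ^ 2) (- (INR m * s)))
          with (qe z ((INR m + 1) ^ 2) (- ((INR m + 1) * s)) * qe z (- (2 * INR m + 1)) s)%C
          by (rewrite qe_add; f_equal; ring).
        ring. }
    specialize (Hm n); fold N in Hm; fold c in Hm.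
    match type of Hm with ?l = _ => transitivity
      (l * (cprod (fun j => 1 - qe z 1 s * qe z 2 0 ^ j) n
            * cprod (fun j => 1 - qe z 1 (- s) * qe z 2 0 ^ j) n))%C end;
      [rewrite Hm; ring | ring]. }
  rewrite HP, HB, <- csum_scal; clear HP HB Hfac.
  (* The 2n + 1 terms are split as n + 1 + n around the middle one, and the lower half is reversed
     so that the indices n - k and n + k can be paired. *)
  replace (S (n + n)) with (n + S n)%nat by lia.
  rewrite csum_add, csum_first, csum_rev.
  set (d := fun k => (qpoch (qe z 2 0) (qe z 2 0) (n + n)
    / (qpoch (qe z 2 0) (qe z 2 0) k * qpoch (qe z 2 0) (qe z 2 0) (n + n - k)))%C).
  (* Completing the square, N^2 + k(k-1) + k(1-2N) = (k-N)^2: this produces the square exponents of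
     theta_4. *)
  assert (HT : forall k, (c * (qe z 1 0 ^ (k * (k - 1)) * x ^ k * d k))%C
     = (RtoC ((-1) ^ n * (-1) ^ k) * qe z ((INR k - N) ^ 2) ((INR k - N) * s) * d k)%C).
  { intros k.
    (* At k = 0 the truncated k - 1 is harmless because of the factor k. *)
    assert (Hk : INR (k * (k - 1)) = INR k * (INR k - 1)).
    { destruct k; [simpl; ring|]; rewrite mult_INR, minus_INR, S_INR by lia; reflexivity. }
    unfold c, x.
    replace (- qe z (1 - 2 * N) s)%C with (RtoC (-1) * qe z (1 - 2 * N) s)%C by ring.
    rewrite Cpow_mult_l, !qe_pow, Hk, <- RtoC_pow, RtoC_mult.
    replace (qe z ((INR k - N) ^ 2) ((INR k - N) * s)) with
      (qe z (N ^ 2) (- (N * s)) * qe z (INR k * (INR k - 1) * 1) (INR k * (INR k - 1) * 0)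
       * qe z (INR k * (1 - 2 * N)) (INR k * s))%C
      by (rewrite !qe_add; f_equal; ring).
    ring. }
  change (csum (fun k => c * (qe z 1 0 ^ ((n - S k) * (n - S k - 1)) * x ^ (n - S k) * d (n - S k)%nat)) n
     + (c * (qe z 1 0 ^ ((n + 0) * (n + 0 - 1)) * x ^ (n + 0) * d (n + 0)%nat)
       + csum (fun k => c * (qe z 1 0 ^ ((n + S k) * (n + S k - 1)) * x ^ (n + S k) * d (n + S k)%nat)) n)
     = central_qbinom z n 0 + csum (fun i => RtoC ((-1) ^ S i)
         * (qe z (INR (S i) ^ 2) (INR (S i) * s) + qe z (INR (S i) ^ 2) (- (INR (S i) * s)))
         * central_qbinom z n (S i)) n)%C.
  assert (Hsq : forall m, (-1) ^ m * (-1) ^ m = 1).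
  { intros m; rewrite <- pow_add; replace (m + m)%nat with (2 * m)%nat by lia; apply pow_1_even. }
  assert (Hd : forall k, d (n + k)%nat = central_qbinom z n k).
  { intros k; unfold d, central_qbinom.
    replace (n + n - (n + k))%nat with (n - k)%nat by lia; reflexivity. }
  assert (Hd' : forall k, (k <= n)%nat -> d (n - k)%nat = central_qbinom z n k).
  { intros k Hk; unfold d, central_qbinom.
    replace (n + n - (n - k))%nat with (n + k)%nat by lia.
    rewrite (Cmult_comm (qpoch _ _ (n - k))); reflexivity. }
  rewrite (HT (n + 0)%nat), Hd, Nat.add_0_r, Hsq; fold N.
  replace (qe z ((N - N) ^ 2) ((N - N) * s)) with (RtoC 1)
    by (rewrite <- (qe_0 z); f_equal; ring).
  transitivity (central_qbinom z n 0
    + (csum (fun k => c * (qe z 1 0 ^ ((n - S k) * (n - S k - 1)) * x ^ (n - S k) * d (n - S k)%nat)) n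
    + csum (fun k => c * (qe z 1 0 ^ ((n + S k) * (n + S k - 1)) * x ^ (n + S k) * d (n + S k)%nat)) n))%C;
    [ring|].
  rewrite <- csum_plus; f_equal; apply csum_ext; intros k Hk.
  rewrite !HT, Hd, Hd' by lia.
  rewrite plus_INR, minus_INR by lia; fold N.
  replace ((-1) ^ n * (-1) ^ (n + S k)) with ((-1) ^ S k)
    by (rewrite pow_add, <- Rmult_assoc, Hsq; ring).
  replace ((-1) ^ n * (-1) ^ (n - S k)) with ((-1) ^ S k).
  2:{ replace n with (n - S k + S k)%nat at 1 by lia.
      rewrite pow_add, (Rmult_comm ((-1) ^ (n - S k)) ((-1) ^ S k)), Rmult_assoc, Hsq; ring. }
  replace (N - INR (S k) - N) with (- INR (S k)) by ring.
  replace (N + INR (S k) - N) with (INR (S k)) by ring.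
  replace ((- INR (S k)) ^ 2) with (INR (S k) ^ 2) by ring.
  replace (- INR (S k) * s) with (- (INR (S k) * s)) by ring.
  ring.
Qed.

(** * The triple product for theta_4 *)

Lemma exp_monotone (x y : R) : x <= y -> exp x <= exp y.
Proof.
  intros [H| ->]; [apply Rlt_le, exp_increasing, H | apply Rle_refl].
Qed.

Lemma ex_series_Rmult_l (c : R) (a : nat -> R) :
  ex_series a -> ex_series (fun k => c * a k).
Proof. intros H; exact (ex_series_scal c a H). Qed.

Lemma ex_series_gaussian (A B : R) :
  0 < A -> ex_series (fun k => INR (S k) * exp (- (A * INR (S k) ^ 2 + B * INR (S k)))).
Proof.
  intros HA.
  (* [n <= exp n], and completing the square gives [n - A n^2 - B n <= K - n]. *)
  set (K := (B - 2) ^ 2 / (4 * A)).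
  apply (ex_series_le (V := R_CompleteNormedModule)
    (fun k => INR (S k) * exp (- (A * INR (S k) ^ 2 + B * INR (S k))))
    (fun k => exp K * exp (-1) ^ k)).
  - intros k; set (n := INR (S k)).
    assert (Hn : 1 <= n) by apply INR_S_ge_1.
    change (Rabs (n * exp (- (A * n ^ 2 + B * n))) <= exp K * exp (-1) ^ k).
    rewrite Rabs_pos_eq by (apply Rmult_le_pos; [lra | apply Rlt_le, exp_pos]).
    replace (exp (-1) ^ k) with (exp (- INR k)).
    2:{ clear n Hn; induction k as [|k IH]; [simpl; rewrite Ropp_0; apply exp_0|].
      rewrite <- tech_pow_Rmult, <- IH, <- exp_plus, S_INR; f_equal; ring. }
    rewrite <- exp_plus.
    apply Rle_trans with (exp n * exp (- (A * n ^ 2 + B * n))).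
    { apply Rmult_le_compat_r; [apply Rlt_le, exp_pos|].
      generalize (exp_ineq1_le n); lra. }
    rewrite <- exp_plus; apply exp_monotone.
    assert (E : INR k = n - 1) by (unfold n; rewrite S_INR; ring); rewrite E.
    assert (0 <= A * (n + (B - 2) / (2 * A)) ^ 2) by (apply Rmult_le_pos; [lra | apply pow2_ge_0]).
    replace (A * (n + (B - 2) / (2 * A)) ^ 2) with (A * n ^ 2 + (B - 2) * n + K) in H
      by (unfold K; field; lra).
    lra.
  - apply ex_series_Rmult_l, ex_series_geom.
    rewrite Rabs_pos_eq by apply Rlt_le, exp_pos.
    rewrite <- exp_0; apply exp_increasing; lra.
Qed.

Lemma ex_series_qpow_gaussian (z : C) (a b : R) :
  0 < Im z -> 0 < a ->
  ex_series (fun k => INR (S k) * Cmod (qpow z (a * INR (S k) ^ 2 + b * INR (S k)))).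
Proof.
  intros Hz Ha; generalize PI_RGT_0; intros HP.
  eapply ex_series_ext; [|apply (ex_series_gaussian (2 * PI * Im z * a) (2 * PI * Im z * b))].
  - intros k; rewrite Cmod_qpow; simpl; f_equal; f_equal; ring.
  - assert (0 < PI * Im z * a)
      by (apply Rmult_lt_0_compat; [apply Rmult_lt_0_compat|]; lra); lra.
Qed.

Lemma ex_series_qpow_sq (z : C) :
  0 < Im z -> ex_series (fun k => Cmod (qpow z (INR (S k) ^ 2))).
Proof.
  intros Hz.
  apply (ex_series_le (V := R_CompleteNormedModule)
    (fun k => Cmod (qpow z (INR (S k) ^ 2)))
    (fun k => INR (S k) * Cmod (qpow z (1 * INR (S k) ^ 2 + 0 * INR (S k))))).
  - intros k; change (Rabs (Cmod (qpow z (INR (S k) ^ 2)))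
      <= INR (S k) * Cmod (qpow z (1 * INR (S k) ^ 2 + 0 * INR (S k)))).
    rewrite Rabs_pos_eq by apply Cmod_ge_0.
    rewrite Rmult_1_l, Rmult_0_l, Rplus_0_r.
    generalize (INR_S_ge_1 k) (Cmod_ge_0 (qpow z (INR (S k) ^ 2))); nra.
  - apply ex_series_qpow_gaussian; lra.
Qed.

Lemma CSeries_0 : CSeries (fun _ => 0%C) = 0%C.
Proof.
  assert (H : csummable (fun k => 0 ^ k)%C)
    by (apply csummable_geom; rewrite Cmod_0; lra).
  transitivity (0 * CSeries (fun k => 0 ^ k))%C; [|ring].
  rewrite <- (CSeries_scal 0 _ H); apply CSeries_ext; intros; ring.
Qed.

Lemma csummable_decr_1 (f : nat -> C) :
  csummable (fun k => f (S k)) -> csummable f.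
Proof. intros H; exact (proj2 (ex_series_incr_1 (fun k => Cmod (f k))) H). Qed.

(** Extends a finite sum over k < n by zeros to a series, the form to which dominated convergence
    applies. *)
Definition truncate (n : nat) (f : nat -> C) (k : nat) : C :=
  if (k <? n)%nat then f k else 0%C.

Lemma CSeries_truncate (n : nat) (f : nat -> C) :
  csummable (truncate n f) /\ CSeries (truncate n f) = csum f n.
Proof.
  revert f; induction n as [|n IH]; intros f.
  - split; [|exact CSeries_0].
    apply csummable_le with (fun k => Cmod 0 ^ k);
      [|apply ex_series_geom_Cmod; rewrite Cmod_0; lra].
    intros k; change (truncate 0 f k) with (RtoC 0); rewrite Cmod_0; apply pow_le; lra.
  - destruct (IH (fun k => f (S k))) as [H1 H2].
    assert (H : csummable (truncate (S n) f)) by exact (csummable_decr_1 (truncate (S n) f) H1).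
    split; [exact H|].
    rewrite (CSeries_incr_1 _ H), csum_first, <- H2; reflexivity.
Qed.

(** The three symbols tend to the same infinite product, so one inverse survives and the limit does
    not depend on [k]. *)
Lemma is_clim_central_qbinom (z : C) (k : nat) :
  0 < Im z ->
  is_clim (fun n => central_qbinom z n k) (cexp (- log_qpoch_inf (qe z 2 0) (qe z 2 0))).
Proof.
  intros Hz.
  assert (Hp : Cmod (qe z 2 0) < 1) by (apply Cmod_qe_lt_1; lra).
  set (l := log_qpoch (qe z 2 0) (qe z 2 0)).
  set (L := log_qpoch_inf (qe z 2 0) (qe z 2 0)).
  assert (Hl : is_clim l L) by (apply is_clim_log_qpoch; exact Hp).
  apply (is_clim_ext (fun n => cexp (l (n + n)%nat + - l (n + k)%nat + - l (n - k)%nat))).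
  - intros n; unfold central_qbinom; rewrite !qpoch_cexp by exact Hp; fold l.
    rewrite !cexp_add, !cexp_opp; field; split; apply cexp_neq_0.
  - apply is_clim_cexp; replace (- L)%C with (L + - L + - L)%C by ring.
    apply is_clim_plus; [apply is_clim_plus|]; [|apply is_clim_opp|apply is_clim_opp].
    + apply (is_clim_subseq l L (fun n => (n + n)%nat)); [|exact Hl].
      intros P [N HN]; exists N; intros; apply HN; lia.
    + apply (is_clim_subseq l L (fun n => (n + k)%nat)); [|exact Hl].
      intros P [N HN]; exists N; intros; apply HN; lia.
    + apply (is_clim_subseq l L (fun n => (n - k)%nat)); [|exact Hl].
      intros P [N HN]; exists (N + k)%nat; intros; apply HN; lia.
Qed.

(** The quotient is the exponential of a combination of three logarithms, each of modulus at most
    [B]; no separate lower bound on the denominator is required. *)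
Lemma Cmod_central_qbinom_le (z : C) :
  0 < Im z -> exists B, 0 < B /\ forall n k, Cmod (central_qbinom z n k) <= B.
Proof.
  intros Hz.
  assert (Hp : Cmod (qe z 2 0) < 1) by (apply Cmod_qe_lt_1; lra).
  destruct (Cmod_log_qpoch_le _ _ Hp Hp) as [B HB].
  exists (exp (3 * B)); split; [apply exp_pos|]; intros n k.
  unfold central_qbinom; rewrite !qpoch_cexp by exact Hp.
  set (l := log_qpoch (qe z 2 0) (qe z 2 0)) in *.
  replace (_ / _)%C with (cexp (l (n + n)%nat + - l (n + k)%nat + - l (n - k)%nat)).
  2:{ rewrite !cexp_add, !cexp_opp; field; split; apply cexp_neq_0. }
  rewrite Cmod_cexp; apply exp_monotone.
  assert (H : forall m, Rabs (Re (l m)) <= B)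
    by (intros m; eapply Rle_trans; [apply re_le_Cmod | apply HB]).
  generalize (H (n + n)%nat) (H (n + k)%nat) (H (n - k)%nat).
  simpl; unfold Rabs; repeat destruct Rcase_abs; unfold Re in *; lra.
Qed.

Definition theta4_term (z : C) (s : R) (k : nat) : C :=
  (RtoC ((-1) ^ S k)
   * (qe z (INR (S k) ^ 2) (INR (S k) * s) + qe z (INR (S k) ^ 2) (- (INR (S k) * s))))%C.

Lemma Cmod_sign_mult (k : nat) (w : C) : Cmod (RtoC ((-1) ^ k) * w) = Cmod w.
Proof. rewrite Cmod_mult, Cmod_R, pow_1_abs; ring. Qed.

Lemma Cmod_theta4_term_le (z : C) (s : R) (k : nat) :
  Cmod (theta4_term z s k) <= 2 * Cmod (qpow z (INR (S k) ^ 2)).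
Proof.
  unfold theta4_term; rewrite Cmod_sign_mult.
  eapply Rle_trans; [apply Cmod_triangle|]; rewrite !Cmod_qe; lra.
Qed.

Lemma theta4_eq (z : C) (t : R) :
  0 < Im z -> theta4 z t = (1 + CSeries (theta4_term z (2 * t)))%C.
Proof.
  intros Hz; unfold theta4, zsum, zsum_nonzero; f_equal.
  - rewrite <- (qe_0 z); unfold sgn1, qe.
    replace (0 ^ 2) with 0 by ring; replace (2 * 0 * t) with 0 by ring; simpl; ring.
  - assert (Hs : forall e : nat -> R,
      csummable (fun k => RtoC ((-1) ^ S k) * qe z (INR (S k) ^ 2) (e k))%C).
    { intros e; apply csummable_le with (fun k => Cmod (qpow z (INR (S k) ^ 2))).
      - intros k; rewrite Cmod_sign_mult, Cmod_qe; apply Rle_refl.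
      - apply ex_series_qpow_sq, Hz. }
    rewrite (CSeries_ext (theta4_term z (2 * t)) (fun k =>
      RtoC ((-1) ^ S k) * qe z (INR (S k) ^ 2) (INR (S k) * (2 * t))
      + RtoC ((-1) ^ S k) * qe z (INR (S k) ^ 2) (- (INR (S k) * (2 * t))))%C)
      by (intros k; unfold theta4_term; ring).
    rewrite CSeries_plus by apply Hs.
    f_equal; apply CSeries_ext; intros k; unfold sgn1, qe.
    + rewrite Zabs2Nat.id, <- INR_IZR_INZ.
      replace (2 * INR (S k) * t) with (INR (S k) * (2 * t)) by ring; ring.
    + change (Z.abs_nat (- Z.of_nat (S k))) with (Z.abs_nat (Z.of_nat (S k))).
      rewrite Zabs2Nat.id, opp_IZR, <- INR_IZR_INZ.
      replace (2 * - INR (S k) * t) with (- (INR (S k) * (2 * t))) by ring.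
      replace ((- INR (S k)) ^ 2) with (INR (S k) ^ 2) by ring; ring.
Qed.

(** Both sides are limits of the same finite product, taken once through its logarithm and once
    through its expansion. The last factor is free of [t], so it cancels in theta_4(t) / theta_4(0)
    and is left as it stands. *)
Lemma jacobi_triple_product (z : C) (t : R) :
  0 < Im z ->
  cexp (log_qpoch_inf (qe z 1 (2 * t)) (qe z 2 0)
        + log_qpoch_inf (qe z 1 (- (2 * t))) (qe z 2 0))
  = (theta4 z t * cexp (- log_qpoch_inf (qe z 2 0) (qe z 2 0)))%C.
Proof.
  intros Hz.
  assert (Hp : Cmod (qe z 2 0) < 1) by (apply Cmod_qe_lt_1; lra).
  assert (Hu : forall s, Cmod (qe z 1 s) < 1) by (intros; apply Cmod_qe_lt_1; lra).
  set (s := 2 * t); set (Q := cexp (- log_qpoch_inf (qe z 2 0) (qe z 2 0))).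
  apply (is_clim_unique (fun n =>
    qpoch (qe z 1 s) (qe z 2 0) n * qpoch (qe z 1 (- s)) (qe z 2 0) n)%C).
  - apply (is_clim_ext (fun n => cexp (log_qpoch (qe z 1 s) (qe z 2 0) n
                                       + log_qpoch (qe z 1 (- s)) (qe z 2 0) n)))%C.
    { intros n; rewrite !qpoch_cexp, cexp_add by auto; reflexivity. }
    apply is_clim_cexp, is_clim_plus; apply is_clim_log_qpoch; auto.
  - apply (is_clim_ext (fun n => central_qbinom z n 0 + CSeries (truncate n
       (fun k => theta4_term z s k * central_qbinom z n (S k)))))%C.
    { intros n; rewrite finite_triple_product by exact Hz.
      rewrite (proj2 (CSeries_truncate _ _)); reflexivity. }
    rewrite theta4_eq by exact Hz; fold s.
    assert (Hsum : csummable (theta4_term z s)).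
    { eapply csummable_le; [intros k; apply Cmod_theta4_term_le|].
      apply ex_series_Rmult_l, ex_series_qpow_sq, Hz. }
    replace ((1 + CSeries (theta4_term z s)) * Q)%C
      with (Q + CSeries (fun k => Q * theta4_term z s k))%C
      by (rewrite CSeries_scal by exact Hsum; ring).
    apply is_clim_plus; [apply is_clim_central_qbinom, Hz|].
    destruct (Cmod_central_qbinom_le z Hz) as [B [HB0 HB]].
    apply (is_clim_CSeries_dominated _ _ (fun k => 2 * B * Cmod (qpow z (INR (S k) ^ 2)))).
    + intros n k; unfold truncate.
      generalize (Cmod_ge_0 (qpow z (INR (S k) ^ 2))) (Cmod_theta4_term_le z s k); intros H1 H2.
      destruct (k <? n)%nat; [|rewrite Cmod_0; nra].
      rewrite Cmod_mult.
      generalize (HB n (S k)) (Cmod_ge_0 (central_qbinom z n (S k)))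
        (Cmod_ge_0 (theta4_term z s k)); intros.
      apply Rle_trans with (2 * Cmod (qpow z (INR (S k) ^ 2)) * B); [|lra].
      apply Rmult_le_compat; assumption.
    + apply ex_series_Rmult_l, ex_series_qpow_sq, Hz.
    + intros k; apply (is_clim_ext_loc (fun n => central_qbinom z n (S k) * theta4_term z s k)%C).
      * exists (S k); intros n Hn; unfold truncate.
        replace (k <? n)%nat with true by (symmetry; apply Nat.ltb_lt; lia); ring.
      * apply is_clim_mult; [apply is_clim_central_qbinom, Hz | apply is_clim_const].
Qed.

(** * The continuous logarithm of theta_4 *)

Definition log_coef (z : C) (k : nat) : C :=
  (qpow z 1 ^ S k * RtoC (- (2)) / (RtoC (INR (S k)) * (1 - qpow z 2 ^ S k)))%C.

Definition log_fourier (z : C) (t : R) : C :=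
  CSeries (fun k => log_coef z k * RtoC (cos (2 * INR (S k) * t)))%C.

(** The extra factor [INR (S k)] pays for differentiating cos(2nt), which gives the Lipschitz bound
    below; it is absorbed by the 1/n in the coefficient. *)
Lemma log_coef_decay (z : C) :
  0 < Im z -> exists M : nat -> R, ex_series M /\
    (forall k, INR (S k) * Cmod (log_coef z k) <= M k).
Proof.
  intros Hz.
  assert (H1 : Cmod (qpow z 1) < 1) by (apply Cmod_qpow_lt_1; lra).
  assert (H2 : Cmod (qpow z 2) < 1) by (apply Cmod_qpow_lt_1; lra).
  exists (fun k => 2 / (1 - Cmod (qpow z 2)) * Cmod (qpow z 1) ^ k); split.
  - apply ex_series_scal_geom_Cmod, H1.
  - intros k; unfold log_coef.
    assert (Hne := one_minus_neq_0 _ (Cmod_pow_S_lt_1 _ k H2)).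
    assert (Hge := Cmod_one_minus_pow_ge _ k H2).
    generalize (INR_S_ge_1 k); intros Hk.
    rewrite Cmod_div by (apply Cmult_neq_0; [apply RtoC_INR_S_neq_0 | exact Hne]).
    rewrite !Cmod_mult, !Cmod_R, (Rabs_pos_eq (INR (S k))), Rabs_Ropp, (Rabs_pos_eq 2),
      Cmod_pow by lra.
    simpl (_ ^ S k).
    set (r := Cmod (qpow z 1)) in *; set (v := Cmod (qpow z 2)) in *.
    set (w := Cmod (1 - qpow z 2 ^ S k)) in *.
    assert (Hr : 0 <= r) by apply Cmod_ge_0.
    assert (Hrk : 0 <= r ^ k) by (apply pow_le; exact Hr).
    replace (INR (S k) * (r * r ^ k * 2 / (INR (S k) * w))) with ((r * r ^ k * 2) * / w)
      by (field; lra).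
    replace (2 / (1 - v) * r ^ k) with (r ^ k * 2 * / (1 - v)) by (field; lra).
    apply Rmult_le_compat; [nra | apply Rlt_le, Rinv_0_lt_compat; lra | nra |].
    apply Rinv_le_contravar; lra.
Qed.

Lemma log_coef_summable (z : C) : 0 < Im z -> csummable (log_coef z).
Proof.
  intros Hz; destruct (log_coef_decay z Hz) as [M [HM HL]].
  apply csummable_le with M; [|exact HM].
  intros k; generalize (HL k) (INR_S_ge_1 k) (Cmod_ge_0 (log_coef z k)); nra.
Qed.

Lemma Rabs_cos_le_1 (x : R) : Rabs (cos x) <= 1.
Proof. apply Rabs_le, COS_bound. Qed.

Lemma Cmod_mult_cos_le (c : C) (x : R) : Cmod (c * RtoC (cos x)) <= Cmod c.
Proof.
  rewrite Cmod_mult, Cmod_R.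
  generalize (Cmod_ge_0 c) (Rabs_cos_le_1 x); nra.
Qed.

Lemma csummable_mult_cos (c : nat -> C) (x : nat -> R) :
  csummable c -> csummable (fun k => c k * RtoC (cos (x k)))%C.
Proof.
  intros H; apply csummable_le with (fun k => Cmod (c k)); [|exact H].
  intros k; apply Cmod_mult_cos_le.
Qed.

Lemma Rabs_cos_minus_le (x y : R) : Rabs (cos x - cos y) <= Rabs (x - y).
Proof.
  rewrite <- (Rmult_1_l (Rabs (x - y))).
  apply (bounded_variation cos (fun u => - sin u)).
  intros t _; split; [apply is_derive_cos|].
  rewrite Rabs_Ropp; apply Rabs_le, SIN_bound.
Qed.

Lemma log_fourier_lipschitz (z : C) :
  0 < Im z -> exists K, 0 < K /\
    forall s t, Cmod (log_fourier z s - log_fourier z t) <= K * Rabs (s - t).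
Proof.
  intros Hz; destruct (log_coef_decay z Hz) as [M [HM HL]].
  assert (HM0 : forall k, 0 <= M k).
  { intros k; eapply Rle_trans; [|apply HL].
    apply Rmult_le_pos; [apply pos_INR | apply Cmod_ge_0]. }
  assert (HS : 0 <= Series M).
  { rewrite <- (Rmult_0_l (Series M)), <- Series_scal_l; apply Series_le; [|exact HM].
    intros k; generalize (HM0 k); lra. }
  (* One factor 2 comes from the bound on [CSeries], the other from the frequency 2n; adding 1 makes
     the constant positive, so that it can be divided by later. *)
  exists (1 + 4 * Series M); split; [lra|]; intros s t.
  assert (Hd := log_coef_summable z Hz).
  unfold log_fourier; rewrite <- CSeries_minus by (apply csummable_mult_cos; exact Hd).
  apply Rle_trans with (2 * Series (fun k => (2 * Rabs (s - t)) * M k)).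
  - apply Cmod_CSeries_le; [|apply ex_series_Rmult_l, HM].
    intros k.
    replace (log_coef z k * RtoC (cos (2 * INR (S k) * s))
             - log_coef z k * RtoC (cos (2 * INR (S k) * t)))%C
      with (log_coef z k * RtoC (cos (2 * INR (S k) * s) - cos (2 * INR (S k) * t)))%C
      by (rewrite RtoC_minus; ring).
    rewrite Cmod_mult, Cmod_R.
    apply Rle_trans with (Cmod (log_coef z k) * (2 * INR (S k) * Rabs (s - t))).
    + apply Rmult_le_compat_l; [apply Cmod_ge_0|].
      eapply Rle_trans; [apply Rabs_cos_minus_le|].
      rewrite <- Rmult_minus_distr_l, Rabs_mult, (Rabs_pos_eq (2 * _));
        [apply Rle_refl | generalize (pos_INR (S k)); lra].
    + generalize (HL k) (Rabs_pos (s - t)); nra.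
  - rewrite Series_scal_l; generalize (Rabs_pos (s - t)); nra.
Qed.

Lemma log_fourier_bounded (z : C) :
  0 < Im z -> exists B, forall t, Cmod (log_fourier z t) <= B.
Proof.
  intros Hz; eexists; intros t; apply Cmod_CSeries_le.
  - intros k; apply Cmod_mult_cos_le.
  - apply log_coef_summable, Hz.
Qed.

Lemma cexp_Ci_add_opp (x : R) :
  (cexp (Ci * RtoC x) + cexp (Ci * RtoC (- x)))%C = RtoC (2 * cos x).
Proof.
  unfold cexp; apply C_eq; simpl; unfold Re, Im; simpl;
    replace (0 * x - 1 * 0) with 0 by ring; replace (0 * - x - 1 * 0) with 0 by ring;
    replace (0 * 0 + 1 * x) with x by ring; replace (0 * 0 + 1 * - x) with (- x) by ring;
    rewrite exp_0, ?cos_neg, ?sin_neg; ring.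
Qed.

Lemma log_fourier_eq (z : C) (t : R) :
  0 < Im z ->
  (log_qpoch_inf (qe z 1 (2 * t)) (qe z 2 0)
   + log_qpoch_inf (qe z 1 (- (2 * t))) (qe z 2 0))%C = log_fourier z t.
Proof.
  intros Hz.
  assert (Hp : Cmod (qe z 2 0) < 1) by (apply Cmod_qe_lt_1; lra).
  assert (Hu : forall s, Cmod (qe z 1 s) < 1) by (intros; apply Cmod_qe_lt_1; lra).
  unfold log_qpoch_inf, log_fourier.
  rewrite <- !CSeries_opp, <- CSeries_plus.
  - apply CSeries_ext; intros k; unfold log_coef.
    assert (Hq2 : qe z 2 0 = qpow z 2).
    { unfold qe; rewrite Cmult_0_r, cexp_0; ring. }
    rewrite Hq2.
    assert (Hne : (1 - qpow z 2 ^ S k)%C <> 0%C)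
      by (apply one_minus_neq_0, Cmod_pow_S_lt_1, Cmod_qpow_lt_1; lra).
    unfold qe; rewrite !Cpow_mult_l, !cexp_pow.
    assert (HC := cexp_Ci_add_opp (2 * INR (S k) * t)).
    replace (RtoC (INR (S k)) * (Ci * RtoC (2 * t)))%C
      with (Ci * RtoC (2 * INR (S k) * t))%C by (rewrite !RtoC_mult; ring).
    replace (RtoC (INR (S k)) * (Ci * RtoC (- (2 * t))))%C
      with (Ci * RtoC (- (2 * INR (S k) * t)))%C by (rewrite !RtoC_opp, !RtoC_mult; ring).
    rewrite (RtoC_mult 2 (cos _)) in HC.
    set (e1 := cexp (Ci * RtoC (2 * INR (S k) * t))) in *.
    set (e2 := cexp (Ci * RtoC (- (2 * INR (S k) * t)))) in *.
    transitivity (- (qpow z 1 ^ S k * (e1 + e2) / (RtoC (INR (S k)) * (1 - qpow z 2 ^ S k))))%C;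
      [|rewrite HC, RtoC_opp]; field; (split; [exact Hne | apply RtoC_INR_S_neq_0]).
  - apply (csummable_le _ _ (fun k => Req_le _ _ (Cmod_opp _))), csummable_log_qpoch_inf; auto.
  - apply (csummable_le _ _ (fun k => Req_le _ _ (Cmod_opp _))), csummable_log_qpoch_inf; auto.
Qed.

(* [L] is continuous on [0, pi] only; precomposing with [clamp] makes the
   intermediate value theorem for functions on the line applicable. *)
Definition clamp (t : R) : R := Rmax 0 (Rmin t PI).

Lemma clamp_range (t : R) : 0 <= clamp t <= PI.
Proof.
  unfold clamp, Rmax, Rmin; generalize PI_RGT_0; repeat destruct Rle_dec; lra.
Qed.

Lemma clamp_id (t : R) : 0 <= t <= PI -> clamp t = t.
Proof. unfold clamp, Rmax, Rmin; repeat destruct Rle_dec; lra. Qed.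

Lemma clamp_lipschitz (s t : R) : Rabs (clamp s - clamp t) <= Rabs (s - t).
Proof.
  unfold clamp, Rmax, Rmin, Rabs; generalize PI_RGT_0;
    repeat destruct Rle_dec; repeat destruct Rcase_abs; lra.
Qed.

Lemma log_theta4_branch_eq (z : C) (L : R -> C) :
  0 < Im z -> log_theta4_branch z L ->
  forall t, 0 <= t <= PI -> L t = (log_fourier z t - log_fourier z 0)%C.
Proof.
  intros Hz [L0 [Lc Le]].
  set (D := fun t => (L t - log_fourier z t + log_fourier z 0)%C).
  assert (HD1 : forall t, 0 <= t <= PI -> cexp (D t) = 1%C).
  { intros t Ht; specialize (Le t Ht).
    generalize (jacobi_triple_product z t Hz) (jacobi_triple_product z 0 Hz).
    rewrite !log_fourier_eq, <- Le by exact Hz.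
    set (Q := cexp (- log_qpoch_inf (qe z 2 0) (qe z 2 0))); intros E1 E2.
    replace (D t) with (L t + - log_fourier z t + log_fourier z 0)%C by (unfold D; ring).
    rewrite !cexp_add, cexp_opp, E2, E1.
    assert (HQ : Q <> 0%C) by apply cexp_neq_0.
    assert (HL := cexp_neq_0 (L t)).
    (* The triple product at t = 0 makes a multiple of theta_4(0) equal to an exponential. *)
    assert (H0 : theta4 z 0 <> 0%C).
    { intros H; rewrite H, Cmult_0_l in E2; exact (cexp_neq_0 _ E2). }
    field; auto. }
  (* Only the imaginary part needs continuity: exp D = 1 already forces the real part to vanish. *)
  assert (Hcont : continuity (fun t => Im (D (clamp t)))).
  { intros t.
    destruct (log_fourier_lipschitz z Hz) as [K [HK0 HK]].
    intros eps Heps.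
    assert (He2 : 0 < eps / 2) by lra.
    specialize (Lc (clamp t) (clamp_range t)
      (fun w => Rabs (Im w - Im (L (clamp t))) < eps / 2)).
    assert (Hloc : locally (L (clamp t))
      (fun w => Rabs (Im w - Im (L (clamp t))) < eps / 2)).
    { exists (mkposreal _ He2); intros w Hw; apply Hw. }
    destruct (Lc Hloc) as [del Hdel].
    exists (Rmin del (eps / (2 * K))); split.
    { apply Rmin_pos; [apply cond_pos|]; apply Rdiv_lt_0_compat; lra. }
    intros s [_ Hs].
    change (Rabs (s - t) < Rmin del (eps / (2 * K))) in Hs.
    change (Rabs (Im (D (clamp s)) - Im (D (clamp t))) < eps).
    assert (Hcl := clamp_lipschitz s t).
    assert (A1 : Rabs (Im (L (clamp s)) - Im (L (clamp t))) < eps / 2).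
    { apply Hdel; [|apply clamp_range].
      change (Rabs (clamp s - clamp t) < del).
      eapply Rle_lt_trans; [exact Hcl|].
      eapply Rlt_le_trans; [exact Hs | apply Rmin_l]. }
    assert (A2 : Rabs (Im (log_fourier z (clamp s)) - Im (log_fourier z (clamp t))) < eps / 2).
    { apply Rle_lt_trans with (K * Rabs (s - t)).
      - apply Rle_trans with (Cmod (log_fourier z (clamp s) - log_fourier z (clamp t))).
        + apply (im_le_Cmod (_ - _)%C).
        + eapply Rle_trans; [apply HK|]; apply Rmult_le_compat_l; lra.
      - apply Rlt_le_trans with (K * (eps / (2 * K))).
        + apply Rmult_lt_compat_l; [exact HK0|].
          eapply Rlt_le_trans; [exact Hs | apply Rmin_r].
        + right; field; lra. }
    replace (Im (D (clamp s)) - Im (D (clamp t)))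
      with ((Im (L (clamp s)) - Im (L (clamp t)))
            - (Im (log_fourier z (clamp s)) - Im (log_fourier z (clamp t))))
      by (unfold D, Cminus, Cplus, Copp, Im; cbn [fst snd]; ring).
    eapply Rle_lt_trans; [apply Rabs_triang|]; rewrite Rabs_Ropp; lra. }
  generalize PI_RGT_0; intros HPI.
  assert (D0 : D 0 = 0%C) by (unfold D; rewrite L0; ring).
  assert (Dk : forall t, exists k : Z, Im (D (clamp t)) = IZR k * (2 * PI)).
  { intros t; exact (proj2 (cexp_eq_1 _ (HD1 _ (clamp_range t)))). }
  (* [Im (D (clamp t))] lies in [2 pi Z], so it never takes the values [pi], [- pi]. *)
  assert (Hno : forall t y, (y = PI \/ y = - PI) ->
     ~ Rmin (Im (D (clamp 0))) (Im (D (clamp t))) <= y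
       <= Rmax (Im (D (clamp 0))) (Im (D (clamp t)))).
  { intros t y Hy Hb.
    destruct (IVT_gen _ 0 t y Hcont Hb) as [x [_ Hx]].
    destruct (Dk x) as [k Hk]; rewrite Hk in Hx.
    assert (E : IZR (2 * k) = 1 \/ IZR (2 * k) = -1)
      by (rewrite mult_IZR; destruct Hy as [-> | ->]; [left | right];
          apply Rmult_eq_reg_r with PI; lra).
    destruct E as [E|E]; apply eq_IZR in E; lia. }
  intros t Ht.
  assert (HDt : D t = 0%C).
  { apply C_eq; [exact (proj1 (cexp_eq_1 _ (HD1 t Ht)))|].
    destruct (Dk t) as [k Hk].
    assert (H1 := Hno t PI (or_introl eq_refl)); assert (H2 := Hno t (- PI) (or_intror eq_refl)).
    rewrite (clamp_id 0), D0, Hk in H1, H2 by lra; simpl in H1, H2.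
    rewrite (clamp_id t Ht) in Hk; rewrite Hk.
    destruct (Z.lt_trichotomy k 0) as [H|[->|H]].
    - exfalso; apply H2.
      assert (IZR k <= -1) by (apply IZR_le; lia).
      rewrite Rmin_right, Rmax_left by nra; split; nra.
    - simpl; ring.
    - exfalso; apply H1.
      assert (1 <= IZR k) by (apply IZR_le; lia).
      rewrite Rmin_left, Rmax_right by nra; split; nra. }
  transitivity (D t + log_fourier z t - log_fourier z 0)%C; [unfold D; ring | rewrite HDt; ring].
Qed.

(** * Termwise integration *)

Lemma is_RInt_sum_n (f : nat -> R -> R) (l : nat -> R) (a b : R) (n : nat) :
  (forall k, is_RInt (f k) a b (l k)) ->
  is_RInt (fun t => sum_n (fun k => f k t) n) a b (sum_n l n).
Proof.
  intros H; induction n as [|n IH].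
  - rewrite sum_O; apply (is_RInt_ext (f 0%nat)); [|apply H].
    intros t _; rewrite sum_O; reflexivity.
  - rewrite sum_Sn.
    apply (is_RInt_ext (fun t => plus (sum_n (fun k => f k t) n) (f (S n) t))).
    + intros t _; rewrite sum_Sn; reflexivity.
    + apply (is_RInt_plus (V := R_NormedModule)); [exact IH | apply H].
Qed.

(** The majorant is required for every real t because [filterlim_RInt] takes uniform limits of
    functions on the whole line. *)
Lemma is_RInt_Series (f : nat -> R -> R) (l M : nat -> R) (a b : R) :
  (forall k t, Rabs (f k t) <= M k) -> ex_series M ->
  (forall k, is_RInt (f k) a b (l k)) ->
  is_RInt (fun t => Series (fun k => f k t)) a b (Series l).
Proof.
  intros Hf HM Hl.
  destruct (filterlim_RInt (V := R_CompleteNormedModule)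
    (fun n t => sum_n (fun k => f k t) n) a b eventually _
    (fun t => Series (fun k => f k t)) (fun n => sum_n l n)) as [I [HI1 HI2]].
  - intros n; apply is_RInt_sum_n, Hl.
  - intros P [eps HP].
    assert (HS : is_lim_seq (sum_n M) (Series M)) by exact (Series_correct _ HM).
    apply is_lim_seq_spec in HS; destruct (HS eps) as [K HK].
    exists K; intros n Hn; apply HP; intros t; specialize (HK n Hn).
    assert (Ht : ex_series (fun k => f k t)).
    { exact (ex_series_le (V := R_CompleteNormedModule) _ M (fun k => Hf k t) HM). }
    change (Rabs (sum_n (fun k => f k t) n - Series (fun k => f k t)) < eps).
    rewrite (Series_incr_n (fun k => f k t) (S n)) by (lia || exact Ht).
    rewrite (Series_incr_n M (S n)) in HK by (lia || exact HM).
    rewrite !sum_n_Reals in *; simpl pred in *.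
    rewrite <- Rabs_Ropp in HK |- *.
    replace (- (sum_f_R0 M n - _)) with (Series (fun k => M (S n + k)%nat)) in HK by ring.
    replace (- (sum_f_R0 _ n - _)) with (Series (fun k => f (S n + k)%nat t)) by ring.
    eapply Rle_lt_trans; [apply (Rabs_Series_le _ (fun k => M (S n + k)%nat))|].
    + intros k; apply Hf.
    + apply ex_series_incr_n, HM.
    + eapply Rle_lt_trans; [apply Rle_abs | exact HK].
  - replace (Series l) with I by (symmetry; apply is_series_unique; exact HI1).
    exact HI2.
Qed.

Lemma is_RInt_C (f : R -> C) (a b : R) (l : C) :
  is_RInt (fun t => Re (f t)) a b (Re l) -> is_RInt (fun t => Im (f t)) a b (Im l) ->
  is_RInt f a b l.
Proof.
  destruct l as [x y]; apply (is_RInt_fct_extend_pair (U := R_NormedModule) (V := R_NormedModule)).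
Qed.

Lemma is_RInt_Re (f : R -> C) (a b : R) (l : C) :
  is_RInt f a b l -> is_RInt (fun t => Re (f t)) a b (Re l).
Proof. apply (is_RInt_fct_extend_fst (U := R_NormedModule) (V := R_NormedModule)). Qed.

Lemma is_RInt_Im (f : R -> C) (a b : R) (l : C) :
  is_RInt f a b l -> is_RInt (fun t => Im (f t)) a b (Im l).
Proof. apply (is_RInt_fct_extend_snd (U := R_NormedModule) (V := R_NormedModule)). Qed.

Lemma is_RInt_CSeries (f : nat -> R -> C) (l : nat -> C) (M : nat -> R) (a b : R) :
  (forall k t, Cmod (f k t) <= M k) -> ex_series M ->
  (forall k, is_RInt (f k) a b (l k)) ->
  is_RInt (fun t => CSeries (fun k => f k t)) a b (CSeries l).
Proof.
  intros Hf HM Hl; apply is_RInt_C.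
  - apply (is_RInt_Series (fun k t => Re (f k t)) (fun k => Re (l k)) M); [|exact HM|].
    + intros k t; eapply Rle_trans; [apply re_le_Cmod | apply Hf].
    + intros k; apply is_RInt_Re, Hl.
  - apply (is_RInt_Series (fun k t => Im (f k t)) (fun k => Im (l k)) M); [|exact HM|].
    + intros k t; eapply Rle_trans; [apply im_le_Cmod | apply Hf].
    + intros k; apply is_RInt_Im, Hl.
Qed.

Lemma is_RInt_Cmult_l (c : C) (f : R -> C) (a b : R) (l : C) :
  is_RInt f a b l -> is_RInt (fun t => c * f t)%C a b (c * l)%C.
Proof.
  intros H; assert (HR := is_RInt_Re _ _ _ _ H); assert (HI := is_RInt_Im _ _ _ _ H).
  apply is_RInt_C.
  - exact (is_RInt_minus _ _ _ _ _ _ (is_RInt_scal _ _ _ (Re c) _ HR)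
             (is_RInt_scal _ _ _ (Im c) _ HI)).
  - exact (is_RInt_plus _ _ _ _ _ _ (is_RInt_scal _ _ _ (Re c) _ HI)
             (is_RInt_scal _ _ _ (Im c) _ HR)).
Qed.

Lemma is_RInt_RtoC (f : R -> R) (a b l : R) :
  is_RInt f a b l -> is_RInt (fun t => RtoC (f t)) a b (RtoC l).
Proof.
  intros H; apply is_RInt_C; [exact H|].
  assert (H0 := is_RInt_const (V := R_NormedModule) a b 0).
  change (is_RInt (fun _ : R => 0) a b ((b - a) * 0)) in H0.
  rewrite Rmult_0_r in H0; exact H0.
Qed.

Lemma is_RInt_cos_0_PI (j : Z) :
  is_RInt (fun t => cos (2 * IZR j * t)) 0 PI (if Z.eq_dec j 0 then PI else 0).
Proof.
  destruct (Z.eq_dec j 0) as [->|Hj].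
  - apply (is_RInt_ext (fun _ => 1)).
    + intros t _; rewrite Rmult_0_r, Rmult_0_l, cos_0; reflexivity.
    + replace PI with (scal (PI - 0) 1) at 2 by (unfold scal; simpl; unfold mult; simpl; ring).
      apply (is_RInt_const (V := R_NormedModule)).
  - assert (Hj' : IZR j <> 0) by (intros E; apply Hj, eq_IZR, E).
    replace 0 with (minus (sin (2 * IZR j * PI) / (2 * IZR j))
                          (sin (2 * IZR j * 0) / (2 * IZR j))) at 2.
    + apply (is_RInt_derive (fun t => sin (2 * IZR j * t) / (2 * IZR j))).
      * intros t _; auto_derive; [exact I | field; exact Hj'].
      * intros t _; apply (ex_derive_continuous (fun t => cos (2 * IZR j * t))).
        auto_derive; exact I.
    + rewrite Rmult_0_r, sin_0.
      rewrite (sin_eq_0_1 (2 * IZR j * PI))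
        by (exists (2 * j)%Z; rewrite mult_IZR; ring).
      unfold minus, plus, opp; simpl; field; exact Hj'.
Qed.

Lemma is_RInt_cos_mult_cos (m n : nat) :
  is_RInt (fun t => cos (2 * INR (S m) * t) * cos (2 * INR (S n) * t)) 0 PI
    (if (m =? n)%nat then PI / 2 else 0).
Proof.
  set (p := Z.of_nat (S m)); set (q := Z.of_nat (S n)).
  assert (H1 := is_RInt_cos_0_PI (p + q)); assert (H2 := is_RInt_cos_0_PI (p - q)).
  (* Both frequencies are at least 1, so only the difference can vanish. *)
  destruct (Z.eq_dec (p + q) 0) as [E|_]; [exfalso; unfold p, q in E; lia|].
  assert (H := is_RInt_scal _ _ _ (/ 2) _ (is_RInt_plus _ _ _ _ _ _ H1 H2)).
  assert (E : scal (/ 2) (plus 0 (if Z.eq_dec (p - q) 0 then PI else 0))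
              = (if (m =? n)%nat then PI / 2 else 0) :> R).
  { change (/ 2 * (0 + (if Z.eq_dec (p - q) 0 then PI else 0))
            = (if (m =? n)%nat then PI / 2 else 0)).
    destruct (Nat.eqb_spec m n) as [E|E]; destruct (Z.eq_dec (p - q) 0) as [E'|E'];
      try (exfalso; unfold p, q in E'; lia); field. }
  refine (eq_ind _ (fun v : R => is_RInt _ 0 PI v) _ _ E).
  refine (is_RInt_ext _ _ _ _ _ _ H); intros t _.
  change (/ 2 * (cos (2 * IZR (p + q) * t) + cos (2 * IZR (p - q) * t))
          = cos (2 * INR (S m) * t) * cos (2 * INR (S n) * t)).
  rewrite plus_IZR, minus_IZR; unfold p, q; rewrite <- !INR_IZR_INZ.
  replace (2 * (INR (S m) + INR (S n)) * t)
    with (2 * INR (S m) * t + 2 * INR (S n) * t) by ring.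
  replace (2 * (INR (S m) - INR (S n)) * t)
    with (2 * INR (S m) * t - 2 * INR (S n) * t) by ring.
  rewrite cos_plus, cos_minus; field.
Qed.

Lemma CSeries_single (c : C) (n : nat) :
  CSeries (fun k => if (k =? n)%nat then c else 0%C) = c.
Proof.
  set (f := fun k => if (k =? n)%nat then c else 0%C).
  rewrite (CSeries_ext f (truncate (S n) f)).
  - rewrite (proj2 (CSeries_truncate _ _)); simpl; unfold f at 2; rewrite Nat.eqb_refl.
    rewrite (csum_ext f (fun _ => 0 * 0)%C).
    + rewrite (csum_scal 0 (fun _ => 0%C)); ring.
    + intros k Hk; unfold f; replace (k =? n)%nat with false
        by (symmetry; apply Nat.eqb_neq; lia); ring.
  - intros k; unfold truncate, f.
    destruct (Nat.ltb_spec k (S n)); [reflexivity|].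
    destruct (Nat.eqb_spec k n); [lia | reflexivity].
Qed.

(** The normalisation at t = 0 only subtracts a constant, which integrates to 0 against a cosine of
    nonzero frequency. *)
Lemma is_RInt_cos_log_fourier (z : C) (n : nat) :
  0 < Im z ->
  is_RInt (fun t => RtoC (cos (2 * INR (S n) * t)) * (log_fourier z t - log_fourier z 0))%C
    0 PI (RtoC (PI / 2) * log_coef z n)%C.
Proof.
  intros Hz; assert (Hd := log_coef_summable z Hz).
  assert (H1 : is_RInt (fun t => CSeries (fun k => log_coef z k
      * RtoC (cos (2 * INR (S k) * t) * cos (2 * INR (S n) * t))))%C 0 PI
      (CSeries (fun k => log_coef z k * RtoC (if (k =? n)%nat then PI / 2 else 0)))%C).
  { apply (is_RInt_CSeries _ _ (fun k => Cmod (log_coef z k))); [|exact Hd|].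
    - intros k t; rewrite RtoC_mult, Cmult_assoc.
      eapply Rle_trans; apply Cmod_mult_cos_le.
    - intros k; apply is_RInt_Cmult_l, is_RInt_RtoC, is_RInt_cos_mult_cos. }
  assert (H2 : is_RInt (fun t => - log_fourier z 0 * RtoC (cos (2 * INR (S n) * t)))%C 0 PI
      (- log_fourier z 0 * RtoC 0)%C).
  { apply is_RInt_Cmult_l, is_RInt_RtoC.
    assert (H := is_RInt_cos_0_PI (Z.of_nat (S n))).
    destruct (Z.eq_dec (Z.of_nat (S n)) 0); [lia|]; rewrite <- INR_IZR_INZ in H; exact H. }
  assert (H := is_RInt_plus (V := C_R_NormedModule) _ _ _ _ _ _ H1 H2).
  replace (RtoC (PI / 2) * log_coef z n)%C with
    (CSeries (fun k => log_coef z k * RtoC (if (k =? n)%nat then PI / 2 else 0))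
      + (- log_fourier z 0 * RtoC 0))%C.
  - refine (is_RInt_ext _ _ _ _ _ _ H); intros t _.
    change (CSeries (fun k => log_coef z k
      * RtoC (cos (2 * INR (S k) * t) * cos (2 * INR (S n) * t)))
      + (- log_fourier z 0 * RtoC (cos (2 * INR (S n) * t)))
      = RtoC (cos (2 * INR (S n) * t)) * (log_fourier z t - log_fourier z 0))%C.
    rewrite (CSeries_ext _ (fun k => RtoC (cos (2 * INR (S n) * t))
        * (log_coef z k * RtoC (cos (2 * INR (S k) * t)))))%C
      by (intros k; rewrite RtoC_mult; ring).
    rewrite CSeries_scal by (apply csummable_mult_cos, Hd).
    fold (log_fourier z t); ring.
  - rewrite (CSeries_ext _ (fun k => if (k =? n)%nat then log_coef z n * RtoC (PI / 2) else 0))%C.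
    + rewrite CSeries_single; ring.
    + intros k; destruct (Nat.eqb_spec k n) as [->|_]; ring.
Qed.

(** A second termwise integration: [log_fourier] is bounded on the whole line, so the summability of
    [c] alone provides the majorant. *)
Lemma is_RInt_cos_series_log_fourier (z : C) (c : nat -> C) :
  0 < Im z -> csummable c ->
  is_RInt (fun t => CSeries (fun k => c k * RtoC (cos (2 * INR (S k) * t)))
                    * (log_fourier z t - log_fourier z 0))%C
    0 PI (CSeries (fun k => c k * (RtoC (PI / 2) * log_coef z k)))%C.
Proof.
  intros Hz Hc; destruct (log_fourier_bounded z Hz) as [B HB].
  apply (is_RInt_ext (fun t => CSeries (fun k => c k * (RtoC (cos (2 * INR (S k) * t))
           * (log_fourier z t - log_fourier z 0))))%C).
  - intros t _.
    rewrite Cmult_comm, <- CSeries_scal by (apply csummable_mult_cos, Hc).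
    apply CSeries_ext; intros k; ring.
  - apply (is_RInt_CSeries (fun k t => c k * (RtoC (cos (2 * INR (S k) * t))
           * (log_fourier z t - log_fourier z 0)))%C _ (fun k => 2 * B * Cmod (c k))).
    + intros k t; rewrite Cmult_assoc, Cmod_mult.
      assert (Hl : Cmod (log_fourier z t - log_fourier z 0) <= 2 * B).
      { eapply Rle_trans; [apply Cmod_triangle|]; rewrite Cmod_opp.
        generalize (HB t) (HB 0); lra. }
      rewrite (Rmult_comm (2 * B)); apply Rmult_le_compat; try apply Cmod_ge_0;
        [apply Cmod_mult_cos_le | exact Hl].
    + apply ex_series_Rmult_l, Hc.
    + intros k; apply is_RInt_Cmult_l, is_RInt_cos_log_fourier, Hz.
Qed.

(** A real factor does not mix the two components, so in contrast to [CSeries_scal] no convergence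
    is assumed. *)
Lemma CSeries_scal_R (c : R) (f : nat -> C) :
  CSeries (fun k => RtoC c * f k)%C = (RtoC c * CSeries f)%C.
Proof.
  unfold CSeries; apply C_eq; simpl.
  - rewrite Rmult_0_l, Rminus_0_r, <- Series_scal_l.
    apply Series_ext; intros n; unfold Re; ring.
  - rewrite Rmult_0_l, Rplus_0_r, <- Series_scal_l.
    apply Series_ext; intros n; unfold Im; ring.
Qed.

(** * The integrals against psi_1, psi_2 and psi *)

Lemma is_RInt_psi1 (z : C) (a b : R) (L : R -> C) :
  0 < Im z -> 0 < a -> log_theta4_branch z L ->
  is_RInt (fun t => (psi1 a b z t * L t)%C) 0 PI
    (- RtoC PI * CSeries (fun k => let n := INR (S k) in
        RtoC ((-1) ^ (S k)) * qpow z (a * n ^ 2 + (b + 1) * n)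
          / (RtoC 1 - qpow z (2 * n))))%C.
Proof.
  intros Hz Ha HL; generalize PI_RGT_0; intros HPI.
  set (c := fun k => (RtoC ((-1) ^ S k * INR (S k))
                      * qpow z (a * INR (S k) ^ 2 + b * INR (S k)))%C).
  assert (Hc : csummable c).
  { eapply csummable_le; [|apply (ex_series_qpow_gaussian z a b Hz Ha)].
    intros k; unfold c; rewrite Cmod_mult, Cmod_R, Rabs_mult, pow_1_abs, Rmult_1_l,
      Rabs_pos_eq by apply pos_INR; apply Rle_refl. }
  assert (H := is_RInt_cos_series_log_fourier z c Hz Hc).
  (* The factor n of psi_1 cancels the 1/n of the logarithm, pi/2 times -2 gives -pi, and q^n raises
     the exponent bn to (b+1)n. *)
  assert (E : CSeries (fun k => c k * (RtoC (PI / 2) * log_coef z k))%C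
    = (- RtoC PI * CSeries (fun k => let n := INR (S k) in
        RtoC ((-1) ^ (S k)) * qpow z (a * n ^ 2 + (b + 1) * n)
          / (RtoC 1 - qpow z (2 * n))))%C).
  { rewrite <- RtoC_opp, <- CSeries_scal_R; apply CSeries_ext; intros k; cbv zeta.
    unfold c, log_coef; rewrite !qpow_pow.
    replace (INR (S k) * 2) with (2 * INR (S k)) by ring.
    replace (qpow z (a * INR (S k) ^ 2 + (b + 1) * INR (S k)))
      with (qpow z (a * INR (S k) ^ 2 + b * INR (S k)) * qpow z (INR (S k) * 1))%C
      by (rewrite qpow_add; f_equal; ring).
    assert (Hne : (1 - qpow z (2 * INR (S k)))%C <> 0%C).
    { apply one_minus_neq_0, Cmod_qpow_lt_1; [exact Hz|].
      generalize (INR_S_ge_1 k); lra. }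
    rewrite (RtoC_div PI 2) by (apply Rgt_not_eq; lra).
    rewrite RtoC_mult, !RtoC_opp.
    field; split; [exact Hne | apply RtoC_INR_S_neq_0]. }
  rewrite <- E; refine (is_RInt_ext _ _ _ _ _ _ H).
  (* The integrands need to agree only between 0 and pi, where [L] is determined. *)
  rewrite Rmin_left, Rmax_right by lra; intros t Ht.
  rewrite (log_theta4_branch_eq z L Hz HL t) by lra; f_equal.
  unfold psi1; apply CSeries_ext; intros k; cbv zeta; unfold c.
  rewrite !RtoC_mult; ring.
Qed.

Lemma psi2_eq (a b : R) (z : C) (t : R) : psi2 a b z t = (- psi1 a (- b) z t)%C.
Proof.
  unfold psi2, psi1; f_equal; apply CSeries_ext; intros k; cbv zeta.
  f_equal; f_equal; ring.
Qed.

Lemma is_RInt_psi2 (z : C) (a b : R) (L : R -> C) :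
  0 < Im z -> 0 < a -> log_theta4_branch z L ->
  is_RInt (fun t => (psi2 a b z t * L t)%C) 0 PI
    (RtoC PI * CSeries (fun k => let n := INR (S k) in
        RtoC ((-1) ^ (S k)) * qpow z (a * n ^ 2 + (- b + 1) * n)
          / (RtoC 1 - qpow z (2 * n))))%C.
Proof.
  intros Hz Ha HL.
  assert (H := is_RInt_Cmult_l (RtoC (-1)) _ _ _ _ (is_RInt_psi1 z a (- b) L Hz Ha HL)).
  cbv zeta in *; match type of H with is_RInt _ _ _ (_ * (_ * ?s))%C =>
    replace (RtoC PI * s)%C with (RtoC (-1) * (- RtoC PI * s))%C by ring end.
  refine (is_RInt_ext _ _ _ _ _ _ H); intros t _.
  change (RtoC (-1) * (psi1 a (- b) z t * L t) = psi2 a b z t * L t)%C.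
  rewrite psi2_eq; ring.
Qed.

(** The factor n cos(2nt) is odd in n, which accounts for the minus sign of psi_2 and removes the
    term n = 0. *)
Lemma psi_eq_zsum (a b : R) (z : C) (t : R) :
  (psi1 a b z t + psi2 a b z t)%C =
     zsum (fun m => let n := IZR m in
       RtoC (sgn1 m) * qpow z (a * n ^ 2 + b * n) * RtoC (n * cos (2 * n * t)))%C.
Proof.
  unfold zsum, zsum_nonzero, psi1, psi2; cbv zeta.
  rewrite Rmult_0_l, Cmult_0_r, Cplus_0_l, <- CSeries_opp.
  f_equal; apply CSeries_ext; intros k; unfold sgn1.
  - rewrite Zabs2Nat.id, <- INR_IZR_INZ, !RtoC_mult; ring.
  - change (Z.abs_nat (- Z.of_nat (S k))) with (Z.abs_nat (Z.of_nat (S k))).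
    rewrite Zabs2Nat.id, opp_IZR, <- INR_IZR_INZ.
    replace (2 * - INR (S k) * t) with (- (2 * INR (S k) * t)) by ring.
    rewrite cos_neg.
    replace (a * (- INR (S k)) ^ 2 + b * - INR (S k))
      with (a * INR (S k) ^ 2 - b * INR (S k)) by ring.
    rewrite !RtoC_mult, RtoC_opp; ring.
Qed.

(** For x > 0 the difference is q^(-x) (1 - q^(2x)) with |q^(2x)| < 1, and it is odd in x. This
    keeps the denominators nonzero for indices of either sign. *)
Lemma qpow_opp_minus_neq_0 (z : C) (x : R) :
  0 < Im z -> x <> 0 -> (qpow z (- x) - qpow z x)%C <> 0%C.
Proof.
  intros Hz Hx.
  assert (pos : forall y, 0 < y -> (qpow z (- y) - qpow z y)%C <> 0%C).
  { intros y Hy H.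
    assert (E : (qpow z (- y) - qpow z y = qpow z (- y) * (1 - qpow z (2 * y)))%C).
    { replace (qpow z y) with (qpow z (- y) * qpow z (2 * y))%C
        by (rewrite qpow_add; f_equal; ring); ring. }
    rewrite E in H; revert H; apply Cmult_neq_0; [apply qpow_neq_0|].
    apply one_minus_neq_0, Cmod_qpow_lt_1; lra. }
  destruct (Rdichotomy x 0 Hx) as [H|H].
  - intros E; apply (pos (- x)); [lra|].
    rewrite Ropp_involutive; transitivity (- (qpow z (- x) - qpow z x))%C; [ring|].
    rewrite E; ring.
  - apply pos; exact H.
Qed.

Theorem theorem4 (z : C) (a b : R) (L : R -> C) :
  0 < Im z -> 0 < a -> log_theta4_branch z L ->
  is_RInt (fun t => (psi1 a b z t * L t)%C) 0 PI
    (- RtoC PI * CSeries (fun k => let n := INR (S k) in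
        RtoC ((-1) ^ (S k)) * qpow z (a * n ^ 2 + (b + 1) * n)
          / (RtoC 1 - qpow z (2 * n))))%C
  /\
  is_RInt (fun t => (psi2 a b z t * L t)%C) 0 PI
    (RtoC PI * CSeries (fun k => let n := INR (S k) in
        RtoC ((-1) ^ (S k)) * qpow z (a * n ^ 2 + (- b + 1) * n)
          / (RtoC 1 - qpow z (2 * n))))%C
  /\
  (forall t : R, (psi1 a b z t + psi2 a b z t)%C =
     zsum (fun m => let n := IZR m in
       RtoC (sgn1 m) * qpow z (a * n ^ 2 + b * n) * RtoC (n * cos (2 * n * t)))%C)
  /\
  (exists I : C,
     is_RInt (fun t => ((psi1 a b z t + psi2 a b z t) * L t)%C) 0 PI I /\
     I = (- RtoC PI * zsum_nonzero (fun m => let n := IZR m in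
            RtoC (sgn1 m) * qpow z (a * n ^ 2 + b * n)
              / (qpow z (- n) - qpow z n)))%C /\
     (I / RtoC PI = / RtoC 2 * zsum_nonzero (fun m => let n := IZR m in
            RtoC (sgn1 m) * cexp (RtoC (2 * PI) * Ci * RtoC (a * n ^ 2 + b * n) * z)
              / csinh (RtoC (2 * PI) * Ci * RtoC n * z)))%C).
Proof.
  intros Hz Ha HL; generalize PI_RGT_0; intros HPI.
  assert (H1 := is_RInt_psi1 z a b L Hz Ha HL).
  assert (H2 := is_RInt_psi2 z a b L Hz Ha HL).
  split; [exact H1|]; split; [exact H2|]; split; [apply psi_eq_zsum|].
  cbv zeta in *.
  set (S1 := CSeries _) in H1; set (S2 := CSeries _) in H2.
  set (g := fun m => (RtoC (sgn1 m) * qpow z (a * IZR m ^ 2 + b * IZR m)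
              / (qpow z (- IZR m) - qpow z (IZR m)))%C).
  assert (HPC : RtoC PI <> 0%C) by (intros E; apply RtoC_inj in E; lra).
  (* Here q^n / (1 - q^(2n)) = 1 / (q^(-n) - q^n), and the denominator changes sign with the index:
     negative indices contribute - [S2]. *)
  assert (Hg : zsum_nonzero g = (S1 - S2)%C).
  { unfold zsum_nonzero, S1, S2, Cminus; rewrite <- CSeries_opp.
    f_equal; apply CSeries_ext; intros k; unfold g, sgn1.
    - rewrite Zabs2Nat.id, <- INR_IZR_INZ.
      assert (Hk := INR_S_ge_1 k).
      assert (N1 := qpow_opp_minus_neq_0 z (INR (S k)) Hz ltac:(lra)).
      assert (N2 : (1 - qpow z (2 * INR (S k)))%C <> 0%C)
        by (apply one_minus_neq_0, Cmod_qpow_lt_1; lra).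
      revert N1 N2.
      replace (2 * INR (S k)) with (INR (S k) + INR (S k)) by ring.
      replace (a * INR (S k) ^ 2 + (b + 1) * INR (S k))
        with ((a * INR (S k) ^ 2 + b * INR (S k)) + INR (S k)) by ring.
      rewrite <- !qpow_add, qpow_opp; intros N1 N2.
      assert (N3 := qpow_neq_0 z (INR (S k))).
      set (y := qpow z (INR (S k))) in *.
      replace (/ y - y)%C with ((1 - y * y) / y)%C by (field; exact N3).
      field; auto.
    - change (Z.abs_nat (- Z.of_nat (S k))) with (Z.abs_nat (Z.of_nat (S k))).
      rewrite Zabs2Nat.id, opp_IZR, <- INR_IZR_INZ, Ropp_involutive.
      assert (Hk := INR_S_ge_1 k).
      assert (N2 : (1 - qpow z (2 * INR (S k)))%C <> 0%C)
        by (apply one_minus_neq_0, Cmod_qpow_lt_1; lra).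
      revert N2.
      replace (2 * INR (S k)) with (INR (S k) + INR (S k)) by ring.
      replace (a * (- INR (S k)) ^ 2 + b * - INR (S k))
        with (a * INR (S k) ^ 2 + - b * INR (S k)) by ring.
      replace (a * INR (S k) ^ 2 + (- b + 1) * INR (S k))
        with ((a * INR (S k) ^ 2 + - b * INR (S k)) + INR (S k)) by ring.
      rewrite <- !qpow_add, qpow_opp; intros N2.
      assert (N3 := qpow_neq_0 z (INR (S k))).
      set (y := qpow z (INR (S k))) in *.
      replace (y - / y)%C with (- (1 - y * y) / y)%C by (field; exact N3).
      field; auto. }
  exists (- RtoC PI * zsum_nonzero g)%C; split; [|split; [reflexivity|]].
  - rewrite Hg; replace (- RtoC PI * (S1 - S2))%C with (- RtoC PI * S1 + RtoC PI * S2)%C by ring.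
    assert (H := is_RInt_plus (V := C_R_NormedModule) _ _ _ _ _ _ H1 H2).
    refine (is_RInt_ext _ _ _ _ _ _ H); intros t _; symmetry; apply Cmult_plus_distr_r.
  (* Since sinh(2 pi i m z) = (q^m - q^(-m)) / 2, passing to the other denominator costs a factor
     -2, which the final 1/2 reduces to the sign. *)
  - assert (Hterm : forall m, m <> 0%Z ->
      (RtoC (sgn1 m) * cexp (RtoC (2 * PI) * Ci * RtoC (a * IZR m ^ 2 + b * IZR m) * z)
         / csinh (RtoC (2 * PI) * Ci * RtoC (IZR m) * z) = RtoC (-2) * g m)%C).
    { intros m Hm; unfold csinh; rewrite cexp_opp.
      change (cexp (RtoC (2 * PI) * Ci * RtoC (IZR m) * z)) with (qpow z (IZR m)).
      change (cexp (RtoC (2 * PI) * Ci * RtoC (a * IZR m ^ 2 + b * IZR m) * z))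
        with (qpow z (a * IZR m ^ 2 + b * IZR m)).
      assert (N := qpow_opp_minus_neq_0 z (IZR m) Hz
                     ltac:(intros E; apply Hm, eq_IZR, E)).
      unfold g; rewrite qpow_opp in *.
      set (y := qpow z (IZR m)) in *; set (y' := (/ y)%C) in *.
      assert (N' : (y - y')%C <> 0%C).
      { intros E; apply N; transitivity (- (y - y'))%C; [ring | rewrite E; ring]. }
      assert (N2 : RtoC 2 <> 0%C) by (intros E; apply RtoC_inj in E; lra).
      replace (y' - y)%C with (- (y - y'))%C by ring.
      field; auto. }
    replace (zsum_nonzero (fun m => RtoC (sgn1 m)
        * cexp (RtoC (2 * PI) * Ci * RtoC (a * IZR m ^ 2 + b * IZR m) * z)
         / csinh (RtoC (2 * PI) * Ci * RtoC (IZR m) * z))%C)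
      with (RtoC (-2) * zsum_nonzero g)%C.
    + field; exact HPC.
    + unfold zsum_nonzero; rewrite Cmult_plus_distr_l, <- !CSeries_scal_R.
      f_equal; apply CSeries_ext; intros k; symmetry; apply Hterm; lia.
Qed.
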